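(* Let $p\in(1,\infty)$. (a) If $k\in K_1$, then $0$ is a critical $(k,p)$-Hardy weight. (b) If $\alpha\in(0,2)\setminus\{1\}$ and $k\in K_\alpha$ is reducible but not zero a.e., then $W_{k,p,s}$ is independent of $s\in(0,\infty)$, nonnegative, and strictly positive on at least one of the half-lines $(0,\infty)$, $(-\infty,0)$. (c) If $\alpha\in(0,2)\setminus\{1\}$ and $k\in K_\alpha$ is irreducible, then there exists a nonempty open interval $S\subset(0,\infty)$ such that $W_{k,p,s}>0$ for all $s\in S$. Furthermore, there exist $s_0>0$ and $D>0$ such that $W_{k,p,s_0}(x)=D|x|^{-\alpha}$ for all $x\in\mathbb{R}$, $x\neq 0$.
   Context: All functions are Borel measurable; $\mathbb{R}_*:=\mathbb{R}\setminus\{0\}$; $q:=p/(p-1)$. For $\alpha\in(0,2)$, $K_\alpha$ is the set of all functions $k:\mathbb{R}^2\to[0,\infty]$ such that $k(x,y)=k(y,x)$ for all $x,y\in\mathbb{R}$; $k(rx,ry)=r^{-\alpha-1}k(x,y)$ for all $x,y\in\mathbb{R}$, $r>0$; and there is a constant $c\in(0,\infty)$ with $k(x,y)\le c|x-y|^{-\alpha-1}$ for all $x,y$. A kernel $k\in K_\alpha$ is reducible if $k(-1,t)=0$ for a.e. $t\in(0,\infty)$, and irreducible if it is not reducible. Write $a^{\langle \kappa\rangle}:=|a|^{\kappa}\operatorname{sign}(a)$, $0^{\langle \kappa\rangle}:=0$, and for $u:\mathbb{R}\to\mathbb{R}$, $$\mathcal{E}_{k,p}[u]:=\frac12\int_{\mathbb{R}}\int_{\mathbb{R}}(u(x)-u(y))\big(u(x)^{\langle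 p-1\rangle}-u(y)^{\langle p-1\rangle}\big)k(x,y)\,dy\,dx\in[0,\infty].$$ A function $w:\mathbb{R}\to\mathbb{R}$, locally integrable on $\mathbb{R}_*$, is a $(k,p)$-Hardy weight if $\mathcal{E}_{k,p}[u]\ge\int_{\mathbb{R}}|u(x)|^pw(x)\,dx$ for all $u\in C_c(\mathbb{R}_* )$. It is critical if moreover it cannot be increased in this inequality on any set of positive Lebesgue measure; i.e. whenever $W\ge w$ a.e. and $W$ is a $(k,p)$-Hardy weight, then $W=w$ a.e. (Weights need only be defined for $x\neq0$.) For $\rho\in(-1,\alpha)$, $r\in(0,\infty)$ put $$\gamma_+(k,\rho):=\int_0^1(1-t^\rho)(1-t^{\alpha-1-\rho})k(1,t)\,dt,\qquad \gamma_-(k,\rho):=\int_0^1(1-t^\rho)(1-t^{\alpha-1-\rho})k(-1,-t)\,dt,$$ $$C_+(k,r,\rho):=\gamma_+(k,\rho)+\int_0^\infty k(1,-t)\,dt-r\int_0^\infty t^\rho k(1,-t)\,dt,$$ $$C_-(k,r,\rho):=\gamma_-(k,\rho)+\int_0^\infty k(-1,t)\,dt-\frac1r\int_0^\infty t^\rho k(-1,t)\,dt ,$$ $$D_\pm(k,p,s,\beta):=\tfrac1p C_\pm\big(k,s^{1/q},\tfrac{\beta}{q}\big)+\tfrac1q C_\pm\big(k,s^{1/p},\tfrac{\beta}{p}\big),\qquad \beta\in(-p,p\alpha)\cap(-q,q\alpha).$$ For $s\in(0,\infty)$, $W_{k,p,s}(x):=|x|^{-\alpha}D_+(k,p,s,\alpha-1)$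 for $x>0$ and $W_{k,p,s}(x):=|x|^{-\alpha}D_-(k,p,s,\alpha-1)$ for $x<0$. *)

(* Defs.v *)
From HB Require Import structures.
From mathcomp Require Import all_boot all_order all_algebra.
From mathcomp Require Import all_classical all_reals all_analysis measurable_realfun.

Set Implicit Arguments.
Unset Strict Implicit.
Unset Printing Implicit Defensive.

Import Order.TTheory GRing.Theory Num.Theory.
Import numFieldNormedType.Exports.

Local Open Scope classical_set_scope.
Local Open Scope ring_scope.

Section Defs.
Context {R : realType}.
Local Notation mu := (@lebesgue_measure R).

(* The class K_alpha.  On the diagonal the bound c * |x - y| `^ (- alpha - 1)
   reads +oo and is void; it is restricted to x != y because powR returns 0
   at 0 `^ a for a != 0. *)
Record hom_kernel (alpha : R) (k : R -> R -> \bar R) : Prop := HomKernel {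
  hom_kernel_measurable : measurable_fun [set: R * R] (fun z => k z.1 z.2) ;
  hom_kernel_ge0 : forall x y, (0 <= k x y)%E ;
  hom_kernel_sym : forall x y, k x y = k y x ;
  hom_kernel_scale : forall x y r, 0 < r ->
    k (r * x) (r * y) = ((r `^ (- alpha - 1))%:E * k x y)%E ;
  hom_kernel_bound : exists c : R, 0 < c /\
    forall x y, x != y -> (k x y <= (c * `|x - y| `^ (- alpha - 1))%:E)%E }.

Definition reducible (k : R -> R -> \bar R) : Prop :=
  {ae mu, forall t, 0 < t -> k (-1) t = 0%E}.

Definition irreducible (k : R -> R -> \bar R) : Prop := ~ reducible k.

Definition kernel_ae0 (k : R -> R -> \bar R) : Prop :=
  {ae (mu \x mu)%E, forall z : R * R, k z.1 z.2 = 0%E}.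

Definition spow (a kappa : R) : R := `|a| `^ kappa * Num.sg a.

Definition energy (k : R -> R -> \bar R) (p : R) (u : R -> R) : \bar R :=
  ((2^-1)%:E * \int[mu]_x \int[mu]_y
    (((u x - u y) * (spow (u x) (p - 1) - spow (u y) (p - 1)))%:E * k x y))%E.

(* The punctured line R_*. *)
Definition Rstar : set R := [set x | x != 0].

(* C_c(R_* ), each function being identified with its extension by 0 to R. *)
Definition Cc_Rstar (u : R -> R) : Prop :=
  continuous u /\
  compact (closure [set x | u x != 0]) /\
  closure [set x | u x != 0] `<=` Rstar.

(* Borel measurability of w on R_* is part of [locally_integrable]; the value
   of w at 0 is irrelevant. *)
Definition hardy_weight (k : R -> R -> \bar R) (p : R) (w : R -> R) : Prop :=
  locally_integrable Rstar w /\
  forall u, Cc_Rstar u ->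
    (\int[mu]_x (`|u x| `^ p * w x)%:E <= energy k p u)%E.

Definition critical_hardy_weight (k : R -> R -> \bar R) (p : R) (w : R -> R) :
    Prop :=
  hardy_weight k p w /\
  forall W : R -> R, hardy_weight k p W ->
    {ae mu, forall x, w x <= W x} -> {ae mu, forall x, W x = w x}.

(* The constants below are kept in \bar R.  For k in K_alpha with
   0 < alpha < 2 and -1 < rho < alpha all the integrals are finite. *)
Definition gamma_plus (alpha : R) (k : R -> R -> \bar R) (rho : R) : \bar R :=
  (\int[mu]_(t in `]0%R, 1%R[)
    (((1 - t `^ rho) * (1 - t `^ (alpha - 1 - rho)))%:E * k 1%R t))%E.

Definition gamma_minus (alpha : R) (k : R -> R -> \bar R) (rho : R) : \bar R :=
  (\int[mu]_(t in `]0%R, 1%R[)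
    (((1 - t `^ rho) * (1 - t `^ (alpha - 1 - rho)))%:E
     * k (-1)%R (- t)%R))%E.

Definition C_plus (alpha : R) (k : R -> R -> \bar R) (r rho : R) : \bar R :=
  (gamma_plus alpha k rho
   + \int[mu]_(t in `]0%R, +oo[) k 1%R (- t)%R
   - r%:E * \int[mu]_(t in `]0%R, +oo[) ((t `^ rho)%:E * k 1%R (- t)%R))%E.

Definition C_minus (alpha : R) (k : R -> R -> \bar R) (r rho : R) : \bar R :=
  (gamma_minus alpha k rho
   + \int[mu]_(t in `]0%R, +oo[) k (-1)%R t
   - (r^-1)%:E * \int[mu]_(t in `]0%R, +oo[) ((t `^ rho)%:E * k (-1)%R t))%E.

Definition conj_exp (p : R) : R := p / (p - 1).

Definition D_plus (alpha : R) (k : R -> R -> \bar R) (p s beta : R) : \bar R :=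
  let q := conj_exp p in
  ((p^-1)%:E * C_plus alpha k (s `^ q^-1) (beta / q)
   + (q^-1)%:E * C_plus alpha k (s `^ p^-1) (beta / p))%E.

Definition D_minus (alpha : R) (k : R -> R -> \bar R) (p s beta : R) : \bar R :=
  let q := conj_exp p in
  ((p^-1)%:E * C_minus alpha k (s `^ q^-1) (beta / q)
   + (q^-1)%:E * C_minus alpha k (s `^ p^-1) (beta / p))%E.

(* W_{k,p,s}; only its values at x != 0 are meaningful. *)
Definition hardy_W (alpha : R) (k : R -> R -> \bar R) (p s x : R) : \bar R :=
  ((`|x| `^ (- alpha))%:E *
   (if (0 < x)%R then D_plus alpha k p s (alpha - 1)
    else D_minus alpha k p s (alpha - 1)))%E.

End Defs.

(* Main.v *)
Require Import Defs.
From HB Require Import structures.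
From mathcomp Require Import all_boot all_order all_algebra.
From mathcomp Require Import all_classical all_reals all_analysis measurable_realfun.
From mathcomp Require Import ring lra.

Import Order.TTheory GRing.Theory Num.Theory.
Import numFieldNormedType.Exports.

Local Open Scope classical_set_scope.
Local Open Scope ring_scope.

(* (a) With E_p[u] <= E_2[u^(p/2)] (AM-GM), the weight 0 is tested against the
   functions phi_N^(2/p), where phi_N is piecewise linear in ln|x|, equal to 1 for
   |ln|x|| <= N and to 0 for |ln|x|| >= 2N.  Since k(x,y) <= c|x-y|^-2, the energy
   is O(1/N), so any larger Hardy weight has zero integral on each annulus.

   (b), (c) Write a = (alpha-1)/q, b = (alpha-1)/p, so a + b = alpha - 1 and ab > 0,
   and I_rho for the integral of t^rho k(1,-t) over t > 0.  The inversion t -> 1/t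
   turns the moments of k(-1,t) into those of k(1,-t), hence
     D_+(s) = gamma_+ + I_0 - s^(1/q) I_a / p - s^(1/p) I_b / q,
     D_-(s) = gamma_- + I_(alpha-1) - s^(-1/q) I_b / p - s^(-1/p) I_a / q.
   In the reducible case every I_rho vanishes.  In the irreducible case
     D_+(s) + s D_-(s) = gamma_+ + s gamma_-
       + int_0^oo s (1 - z^(1/p)) (1 - z^(1/q)) k(-1,t) dt > 0,  z = t^(alpha-1)/s,
   for every s, while D_+ - D_- changes sign; at a zero s_0 of D_+ - D_- the common
   value is positive, and positivity persists near s_0. *)

(** * Substitutions, power integrals and almost-everywhere reasoning for Lebesgue measure *)

Section Integration.
Context {R : realType}.
Local Notation mu := (@lebesgue_measure R).
Local Open Scope ereal_scope.

(** In (a) the rate 1/N is a balance: phi_N has slope 1/N in ln|x|, which puts a factor N^-2 on the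
    energy, while its support has logarithmic length of order N. This requires dominating (ln|x| -
    ln|y|)^2 / |x - y|^2 by a function homogeneous of degree -2 with finite integral in y, hence
    with integral a multiple of 1/|x|; [log_majorant] plays that part. In (c) the factor s in D_+ +
    s D_- is chosen so that s^(1/q) I_a and s^(1/p) I_b each collect the coefficients 1/p and 1/q,
    whose sum is 1; the integrand then factors through s = s^(1/p) s^(1/q) and t^(alpha-1) = t^a
    t^b. The sign change comes from the ends: for large s the positive powers drive D_+ to -oo while
    D_- stays bounded below, and for small s the roles are exchanged. Both ends use I_a, I_b > 0, a
    second consequence of irreducibility. The assumption alpha != 1 gives a and b the same strict
    sign, so that (1 - t^a)(1 - t^b) > 0 off t = 1, and makes z depend on t, so that z = 1 only on a
    null set. *)

Lemma ge0_integral_affine (r c : R) (f : R -> \bar R) : r != 0%R ->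
  measurable_fun [set: R] f -> (forall x, 0 <= f x) ->
  \int[mu]_x f x = `|r|%:E * \int[mu]_x f (r * x + c)%R.
Proof.
move=> r0 mf f0.
pose g := (fun x : measurableTypeR R => (r * x + c)%R : measurableTypeR R).
have mg : measurable_fun [set: measurableTypeR R] g.
  by apply: measurable_funD => //; apply: measurable_funM.
pose nr : {nonneg R} := NngNum (normr_ge0 r).
pose nu0 : {measure set (measurableTypeR R) -> \bar R} := pushforward mu g.
pose nu := nu0 mg.
(* Lebesgue measure is determined by its values on half-open intervals. For negative [r] the
   preimage of such an interval is open at the other end, whence the two cases. *)
have H : forall A, measurable A -> mu A = mscale nr nu A.
  apply: lebesgue_measure_unique => _ [[a b] _ <-] /=.
  rewrite /mscale /nu /nu0 /pushforward /=.
  have [rp|rn] := ltP 0%R r.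
    rewrite [X in _ * mu X](_ : _ = `]((a - c) / r)%R, ((b - c) / r)%R]%classic); last first.
      apply/seteqP; split => x /=; rewrite /g !in_itv/= ltr_pdivrMr// ler_pdivlMr//.
        by move=> /andP[? ?]; apply/andP; split; lra.
      by move=> /andP[? ?]; apply/andP; split; lra.
    rewrite !lebesgue_measure_itv/= !lte_fin ltr_pM2r ?invr_gt0// ltrD2r.
    case: ifPn => _; last by rewrite mule0.
    rewrite -!EFinB -EFinM gtr0_norm//; congr EFin; field.
    by rewrite gt_eqF.
  have {}rn : (r < 0)%R by rewrite lt_neqAle r0.
  rewrite [X in _ * mu X](_ : _ = `[((b - c) / r)%R, ((a - c) / r)%R[%classic); last first.
    apply/seteqP; split => x /=; rewrite /g !in_itv/= ltr_ndivlMr// ler_ndivrMr//.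
      by move=> /andP[? ?]; apply/andP; split; lra.
    by move=> /andP[? ?]; apply/andP; split; lra.
  rewrite !lebesgue_measure_itv/= !lte_fin ltr_nM2r ?invr_lt0// ltrD2r.
  case: ifPn => _; last by rewrite mule0.
  rewrite -!EFinB -EFinM ltr0_norm//; congr EFin; field.
  by rewrite lt_eqF.
rewrite (@eq_measure_integral _ _ _ _ (mscale nr nu)); last first.
  by move=> A mA _; exact: H.
rewrite ge0_integral_mscale//.
by rewrite /nu /nu0 ge0_integral_pushforward// => x _; exact: f0.
Qed.


(** Integrands are moved to the whole line because the affine substitution and Tonelli are stated
    there; the boolean test keeps measurability a matter of [measurable_fun_ifT]. *)
Lemma integral_if (D : set R) (b : pred R) (f : R -> \bar R) :
  (forall x, D x <-> b x) ->
  \int[mu]_(x in D) f x = \int[mu]_x (if b x then f x else 0).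
Proof.
move=> Db; rewrite integral_mkcond; apply: eq_integral => x _.
by rewrite patchE; congr (if _ then _ else _); apply/idP/idP => [/set_mem/Db|/Db/mem_set].
Qed.

Lemma integral_inv_itv (a b : R) : (0 < a)%R -> (a < b)%R ->
  \int[mu]_(x in `[a, b]) (x^-1)%:E = (ln b - ln a)%:E.
Proof.
move=> a0 ab; rewrite (@continuous_FTC2 _ _ (@ln R))//.
- apply: continuous_in_subspaceT => x; rewrite inE/= in_itv/= => /andP[ax _].
  by apply: inv_continuous; rewrite gt_eqF// (lt_le_trans a0).
- split.
  + move=> x; rewrite in_itv/= => /andP[ax _].
    by apply: ex_derive; apply: is_derive1_ln; rewrite (lt_trans a0).
  + by apply: cvg_at_right_filter; exact: continuous_ln.
  + by apply: cvg_at_left_filter; apply: continuous_ln; exact: lt_trans ab.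
- move=> x; rewrite in_itv/= => /andP[ax _]; rewrite derive1E.
  by have [_ ->] := is_derive1_ln (lt_trans a0 ax).
Qed.

Lemma powR_cvgy0 (s : R) : (s < 0)%R -> (t `^ s)%R @[t --> +oo%R] --> (0 : R)%R.
Proof.
move=> s0; apply/cvgrPdist_le => /= e e0; near=> t.
have t0 : (0 < t)%R by near: t; exact: nbhs_pinfty_gt.
rewrite sub0r normrN ger0_norm ?powR_ge0//.
have -> : e = ((e `^ s^-1) `^ s)%R.
  by rewrite -powRrM mulVf ?lt_eqF// powRr1// ltW.
rewrite -[s]opprK 2!(powRN _ (- s)) lef_pV2 ?posrE ?powR_gt0//.
apply: ge0_ler_powR; rewrite ?nnegrE ?powR_ge0 ?oppr_ge0// ltW//.
Unshelve. end_near. Qed.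

Lemma continuous_powR_gt0 (s x : R) : (0 < x)%R ->
  {for x, continuous (fun t : R => t `^ s)%R}.
Proof.
move=> x0; apply/differentiable_continuous/derivable1_diffP/derivable_powR.
by rewrite in_itv/= andbT.
Qed.

Lemma integral_powR_tail (s : R) : (s < -1)%R ->
  \int[mu]_(t in `[1%R, +oo[) (t `^ s)%:E = (- (s + 1)^-1)%:E.
Proof.
move=> s1.
have s10 : (s + 1 != 0)%R by rewrite lt_eqF//; lra.
rewrite (@ge0_continuous_FTC2y _ _ (fun t => (s + 1)^-1 * t `^ (s + 1))%R _ 0%R).
- by rewrite powR1 mulr1 -EFinB sub0r.
- by move=> x _; exact: powR_ge0.
- apply: continuous_in_subspaceT => x; rewrite inE/= in_itv/= andbT => x1.
  by apply: continuous_powR_gt0; rewrite (lt_le_trans ltr01).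
- rewrite -[X in _ --> X](mulr0 (s + 1)^-1)%R; apply: cvgM; first exact: cvg_cst.
  by apply: powR_cvgy0; lra.
- move=> x x1; apply: derivableM; first exact: derivable_cst.
  by apply: derivable_powR; rewrite in_itv/= andbT (lt_trans ltr01).
- apply: cvg_at_right_filter; apply: cvgM; first exact: cvg_cst.
  exact: (continuous_powR_gt0 _ _ ltr01).
- move=> x; rewrite in_itv/= andbT => x1.
  have x0 : (0 < x)%R by rewrite (lt_trans ltr01).
  rewrite derive1E deriveZ/=; last by apply: derivable_powR; rewrite in_itv/= andbT.
  rewrite -derive1E powR_derive1 ?in_itv/= ?andbT// addrK.
  by rewrite /GRing.scale/= mulrA mulVf// mul1r.
Qed.


Lemma mulr_powRD1 (x s : R) : (0 < x)%R -> (x * x `^ s = x `^ (s + 1))%R.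
Proof.
move=> x0; rewrite powRD; last by rewrite lt0r_neq0 ?implybT.
by rewrite powRr1 ?ltW// mulrC.
Qed.

Lemma ge0_integral_swap (f : R -> R -> \bar R) :
  measurable_fun [set: R * R] (fun z => f z.1 z.2) ->
  (forall x y, 0 <= f x y) ->
  \int[mu]_x \int[mu]_y f x y = \int[mu]_y \int[mu]_x f x y.
Proof. by move=> mf f0; exact: (@fubini_tonelli _ _ _ _ _ mu mu (fun z => f z.1 z.2)). Qed.

Lemma measurable_powRl d (T : measurableType d) (D : set T) (f : T -> R) (s : R) :
  measurable_fun D f -> measurable_fun D (fun x => f x `^ s)%R.
Proof.
move=> mf; exact: (@measurableT_comp _ _ _ _ _ _ (fun x : R => x `^ s)%R).
Qed.

(** This is the kernel x^-2 f(y/x), restricted to x, y > 0 and 1 < x + y < e, after the substitution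
    y = x t, whose Jacobian x leaves x^-1. *)
Let dil (f : R -> \bar R) (x t : R) : \bar R :=
  if [&& 0 < x, 0 < t, 1 < x * (1 + t) & x * (1 + t) < expR 1]%R
  then (x `^ (-1))%:E * f t else 0.

Let dil_ge0 f x t : (forall t, 0 <= f t) -> 0 <= dil f x t.
Proof.
by move=> f0; rewrite /dil; case: ifP => // _; rewrite mule_ge0// lee_fin powR_ge0.
Qed.

Let measurable_dil f : measurable_fun [set: R] f ->
  measurable_fun [set: R * R] (fun z => dil f z.1 z.2).
Proof.
move=> mf; apply: measurable_fun_ifT => //.
- have m1 : measurable_fun [set: R * R] (fun z => z.1 * (1 + z.2))%R.
    by apply: measurable_funM => //; apply: measurable_funD.
  by repeat apply: measurable_and; apply: measurable_fun_ltr.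
- apply: emeasurable_funM; last exact: measurableT_comp.
  by apply/measurable_EFinP; exact: measurable_powRl.
Qed.

(** For fixed t the variable x runs over ]1/(1+t), e/(1+t)[, on which x^-1 has integral ln e = 1
    whatever t is; the bound e was chosen for this normalisation. *)
Let integral_dil f : measurable_fun [set: R] f -> (forall t, 0 <= f t) ->
  \int[mu]_x \int[mu]_t dil f x t = \int[mu]_(t in `]0%R, +oo[) f t.
Proof.
move=> mf f0.
rewrite ge0_integral_swap; last 2 first.
- exact: measurable_dil.
- by move=> x y; exact: dil_ge0.
rewrite [RHS](@integral_if _ (fun t => 0 < t)%R); last first.
  by move=> x; rewrite set_itvE /=.
apply: eq_integral => t _; rewrite /dil/=.
case: ifPn => [t0|t0]; last first.
  by rewrite integral0_eq// => x _; rewrite andbF.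
have t10 : (0 < 1 + t)%R by lra.
pose a := ((1 + t)^-1)%R; pose b := (expR 1 * a)%R.
have a0 : (0 < a)%R by rewrite invr_gt0.
have e1 : (1 < expR 1 :> R)%R by rewrite expR_gt1.
have ab : (a < b)%R by rewrite /b ltr_pMl.
transitivity (\int[mu]_(x in `]a, b[) ((x `^ (-1))%:E * f t)).
  rewrite [RHS](@integral_if _ (fun x => (a < x) && (x < b))%R); last first.
    by move=> x; rewrite set_itvE /=.
  apply: eq_integral => x _; congr (if _ then _ else _).
  rewrite -(ltr_pdivrMr x 1 t10) -(ltr_pdivlMr x _ t10) div1r -/a -/b.
  by case: (ltP 0%R x) => //= x0; rewrite ltNge (le_trans x0)// ltW.
rewrite ge0_integralZr//; last first.
- by move=> x _; rewrite lee_fin powR_ge0.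
- apply/measurable_EFinP; apply: measurable_funTS; exact: measurable_powR.
rewrite (_ : \int[_]_(_ in _) _ = 1) ?mul1e//.
rewrite -(@integral_itv_bndoo _ _ _ _ true false); last first.
  apply/measurable_EFinP; apply: measurable_funTS; exact: measurable_powR.
transitivity (\int[mu]_(x in `[a, b]) (x^-1)%:E).
  apply: eq_integral => x; rewrite inE/= in_itv/= => /andP[ax _].
  by rewrite powR_inv1// ltW// (lt_le_trans a0).
rewrite integral_inv_itv// /b lnM ?posrE ?expR_gt0// expRK.
by congr EFin; rewrite addrK.
Qed.

(* Integrating the homogeneous kernel x^-2 f(y/x) over 1 < x + y < e
   first in y and first in x gives the two sides. *)
Lemma ge0_integral_powRN1 (f : R -> \bar R) :
  measurable_fun [set: R] f -> (forall t, 0 <= f t) ->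
  \int[mu]_(t in `]0%R, +oo[) f t =
  \int[mu]_(t in `]0%R, +oo[) ((t `^ (-2))%:E * f (t `^ (-1))%R).
Proof.
move=> mf f0.
pose g t := (t `^ (-2))%:E * f (t `^ (-1))%R.
have g0 t : 0 <= g t by rewrite mule_ge0// lee_fin powR_ge0.
have mg : measurable_fun [set: R] g.
  apply: emeasurable_funM.
    by apply/measurable_EFinP; exact: measurable_powR.
  by apply: (measurableT_comp mf); exact: measurable_powR.
rewrite -[LHS](integral_dil f mf f0) -[RHS](integral_dil g mg g0).
pose h x y := if [&& 0 < x, 0 < y, 1 < x + y & x + y < expR 1]%R
  then (x `^ (-2))%:E * f (y * x `^ (-1))%R else 0.
have h0 x y : 0 <= h x y.
  by rewrite /h; case: ifPn => _ //; rewrite mule_ge0// lee_fin powR_ge0.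
have mh : measurable_fun [set: R * R] (fun z => h z.1 z.2).
  apply: measurable_fun_ifT => //.
    have m1 : measurable_fun [set: R * R] (fun z => z.1 + z.2)%R.
      exact: measurable_funD.
    by repeat apply: measurable_and; apply: measurable_fun_ltr.
  apply: emeasurable_funM.
    by apply/measurable_EFinP; exact: measurable_powRl.
  apply: (measurableT_comp mf); apply: measurable_funM => //.
  by exact: measurable_powRl.
have mh1 x : measurable_fun [set: R] (h x).
  exact: (measurableT_comp mh (measurable_pair1 x)).
have mh2 y : measurable_fun [set: R] (h ^~ y).
  exact: (measurableT_comp mh (measurable_pair2 y)).
transitivity (\int[mu]_x \int[mu]_y h x y).
  apply: eq_integral => x _; have [x0|x0] := ltP 0%R x; last first.
    by rewrite !integral0_eq// => y _; rewrite /h /dil ltNge x0.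
  rewrite [RHS](@ge0_integral_affine x 0%R) ?gt_eqF//.
  rewrite -ge0_integralZl//; last first.
    apply: measurableT_comp (mh1 x) _.
    by apply: measurable_funD => //; apply: measurable_funM.
  apply: eq_integral => t _; rewrite /dil /h addr0 pmulr_rgt0// mulrDr mulr1 x0/=.
  case: ifPn => _; last by rewrite mule0.
  rewrite muleA -EFinM gtr0_norm//; congr (_%:E * f _).
    by rewrite mulr_powRD1//; congr powR; lra.
  by rewrite mulrAC powR_inv1 ?ltW// mulfV ?gt_eqF// mul1r.
rewrite (ge0_integral_swap h mh h0).
apply: eq_integral => y _; have [y0|y0] := ltP 0%R y; last first.
  by rewrite !integral0_eq// => x _; rewrite /h /dil (ltNge _ y) y0/= ?andbF.
rewrite [LHS](@ge0_integral_affine y 0%R) ?gt_eqF//.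
rewrite -ge0_integralZl//; last first.
  apply: measurableT_comp (mh2 y) _.
  by apply: measurable_funD => //; apply: measurable_funM.
apply: eq_integral => t _.
rewrite /dil /h addr0 pmulr_rgt0// mulrDr mulr1 y0/= (addrC _ y).
case: ifPn => [/andP[t0 _]|_]; last by rewrite mule0.
rewrite /g 2!muleA -!EFinM gtr0_norm//; congr (_%:E * f _).
  rewrite powRM ?ltW// mulrA; congr (_ * _)%R.
  by rewrite mulr_powRD1//; congr powR; lra.
by rewrite powRM ?ltW// mulrA powR_inv1 ?ltW// mulfV ?gt_eqF// mul1r.
Qed.


Lemma ge0_integral_halves (f : R -> \bar R) :
  measurable_fun [set: R] f -> (forall t, 0 <= f t) ->
  \int[mu]_t f t =
  \int[mu]_(t in `]0%R, +oo[) f t + \int[mu]_(t in `]0%R, +oo[) f (- t)%R.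
Proof.
move=> mf f0.
have TE : [set: R] `\ 0%R = `]0%R, +oo[ `|` `]-oo, 0%R[.
  apply/seteqP; split => [x [_ /= /eqP]|x].
    by rewrite neq_lt => /orP[?|?]; [right|left]; rewrite /= in_itv/= ?andbT.
  rewrite /= !in_itv/= andbT => xn0; split => // x0.
  by move: xn0; rewrite x0 ltxx; case.
have mT : measurable ([set: R] `\ 0%R) by apply: measurableD => //; exact: measurable_set1.
rewrite -(@integral_setD1 _ _ 0%R)//; last exact: measurable_funTS.
rewrite TE ge0_integral_setU//; last first.
- rewrite disj_set2E; apply/eqP/seteqP; split => // x [] /=.
  by rewrite !in_itv/= andbT => x0 x1; move: (lt_trans x0 x1); rewrite ltxx.
- exact: measurable_funTS.
congr (_ + _).
have mg : measurable_fun [set: R] (fun x => if (x < 0)%R then f x else 0).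
  by apply: measurable_fun_ifT => //; apply: measurable_fun_ltr.
rewrite [LHS](@integral_if _ (fun x => x < 0)%R); last by move=> x; rewrite set_itvE/=.
rewrite [RHS](@integral_if _ (fun x => 0 < x)%R); last by move=> x; rewrite set_itvE/=.
rewrite [LHS](@ge0_integral_affine (-1)%R 0%R)//; last by move=> x; case: ifP.
rewrite normrN1 mul1e; apply: eq_integral => x _.
by rewrite mulN1r addr0 oppr_lt0.
Qed.

Lemma integral_powR_lty (f : R -> \bar R) (c r s : R) :
  (0 <= c)%R -> (-1 < r)%R -> (s < -1)%R ->
  measurable_fun [set: R] f -> (forall t, 0 <= f t) ->
  (forall t, (0 < t <= 1)%R -> f t <= (c * t `^ r)%:E) ->
  (forall t, (1 < t)%R -> f t <= (c * t `^ s)%:E) ->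
  \int[mu]_(t in `]0%R, +oo[) f t < +oo.
Proof.
move=> c0 r1 s1 mf f0 fr fs.
pose g1 (t : R) : \bar R := if (t <= 1)%R then (t `^ r)%:E else 0.
pose g2 (u : R) (t : R) : \bar R := if (1 <= t)%R then (t `^ u)%:E else 0.
have g10 t : 0 <= g1 t by rewrite /g1; case: ifPn => //; rewrite lee_fin powR_ge0.
have g20 u t : 0 <= g2 u t by rewrite /g2; case: ifPn => //; rewrite lee_fin powR_ge0.
have mpow u : measurable_fun [set: R] (fun t : R => (t `^ u)%:E).
  by apply/measurable_EFinP; exact: measurable_powR.
have mg1 : measurable_fun [set: R] g1.
  by apply: measurable_fun_ifT => //; apply: measurable_fun_ler.
have mg2 u : measurable_fun [set: R] (g2 u).
  by apply: measurable_fun_ifT => //; apply: measurable_fun_ler.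
have g2lty u : (u < -1)%R -> \int[mu]_(t in `]0%R, +oo[) g2 u t < +oo.
  move=> u1; suff -> : \int[mu]_(t in `]0%R, +oo[) g2 u t = (- (u + 1)^-1)%:E.
    by rewrite ltry.
  rewrite -integral_powR_tail//.
  rewrite [LHS](@integral_if _ (fun x => 0 < x)%R); last by move=> x; rewrite set_itvE/=.
  rewrite [RHS](@integral_if _ (fun x => 1 <= x)%R); last by move=> x; rewrite set_itvE/=.
  apply: eq_integral => x _; rewrite /g2.
  by case: (ltP 0%R x) => // x0; rewrite lt_geF// (le_lt_trans x0).
have g1lty : \int[mu]_(t in `]0%R, +oo[) g1 t < +oo.
  (* Inversion turns t^r on ]0, 1] into t^(-r-2) on [1, oo[, and -r - 2 < -1 exactly when r > -1, so
     only tails have to be integrated. *)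
  rewrite ge0_integral_powRN1//.
  rewrite (_ : \int[_]_(_ in _) _ = \int[mu]_(t in `]0%R, +oo[) g2 (- r - 2)%R t).
    by apply: g2lty; lra.
  apply: eq_integral => x; rewrite inE/= in_itv/= andbT => x0.
  rewrite /g1 /g2 /= (powR_inv1 (ltW x0)) invf_le1//; case: ifPn => _; last by rewrite mule0.
  rewrite -EFinM -(powR_inv1 (ltW x0)) -powRrM mulN1r -powRD ?lt0r_neq0 ?implybT//.
  by congr (_ `^ _)%:E; lra.
apply: (@le_lt_trans _ _ (\int[mu]_(t in `]0%R, +oo[) (c%:E * (g1 t + g2 s t)%E))).
  apply: ge0_le_integral => //.
  - exact: measurable_funTS.
  - apply: measurable_funTS; apply: measurable_funeM; apply: emeasurable_funD;
      [exact: mg1|exact: mg2].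
  - move=> t /=; rewrite in_itv/= andbT => t0; rewrite /g1 /g2.
    have [t1|t1] := leP t 1%R.
      apply: (le_trans (fr _ _)); first by rewrite t0.
      by rewrite EFinM lee_wpmul2l// leeDl// g20.
    rewrite add0e (ltW t1).
    by apply: (le_trans (fs _ t1)); rewrite EFinM.
rewrite ge0_integralZl//; last 2 first.
- apply: measurable_funTS; apply: emeasurable_funD;
      [exact: mg1|exact: mg2].
- by move=> t _; rewrite adde_ge0.
rewrite ge0_integralD//; [|exact: measurable_funTS|by apply: measurable_funTS; exact: mg2].
apply: lte_mul_pinfty; [by []..|apply: lte_add_pinfty; [exact: g1lty|exact: g2lty]].
Qed.

Lemma ae_impl (P Q : R -> Prop) : (forall x, P x -> Q x) ->
  {ae mu, forall x, P x} -> {ae mu, forall x, Q x}.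
Proof. by move=> PQ; apply: filterS PQ; exact: (ae_filter_ringOfSetsType mu). Qed.

Lemma ae_impl2 (P Q S : R -> Prop) : (forall x, P x -> Q x -> S x) ->
  {ae mu, forall x, P x} -> {ae mu, forall x, Q x} -> {ae mu, forall x, S x}.
Proof. by move=> PQS; apply: filterS2 PQS; exact: (ae_filter_ringOfSetsType mu). Qed.

Lemma ge0_integral_eq0_ae (D : set R) (f : R -> \bar R) : measurable D ->
  measurable_fun D f -> (forall t, D t -> (0 <= f t)%E) ->
  (\int[mu]_(t in D) f t)%E = 0%E -> {ae mu, forall t, D t -> f t = 0%E}.
Proof.
move=> mD mf f0 if0; apply/(@ae_eq_integral_abs _ _ _ mu D mD f mf).
by rewrite -[RHS]if0; apply: eq_integral => t; rewrite inE => /f0; exact: gee0_abs.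
Qed.

Lemma ae_neq (c : R) : {ae mu, forall x : R, x != c}.
Proof.
exists [set c]; split; [exact: measurable_set1|exact: lebesgue_measure_set1|].
by move=> x /= /negP; rewrite negbK => /eqP.
Qed.

End Integration.

Arguments ge0_integral_eq0_ae {R D f}.
Arguments ae_impl {R P Q}.
Arguments ae_impl2 {R P Q S}.
Arguments ae_neq {R}.

(** * The weights (1 - t^a)(1 - t^b): sign, size near 0 and 1, integrability *)

Section PowerWeights.
Context {R : realType}.
Local Notation mu := (@lebesgue_measure R).
Implicit Types a b s t x y alpha c : R.

Lemma ler_powR_le0 (s x y : R) : s <= 0 -> 0 < x -> x <= y -> y `^ s <= x `^ s.
Proof.
move=> s0 x0 xy; rewrite -[s]opprK !(powRN _ (- s)) lef_pV2 ?posrE ?powR_gt0//.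
  by apply: ge0_ler_powR; rewrite ?nnegrE ?oppr_ge0// ltW// (lt_le_trans x0).
exact: lt_le_trans xy.
Qed.

(** Since ab > 0, the numbers a ln t and b ln t have the same sign, so t^a and t^b lie on the same
    side of 1. *)
Lemma powR_weight_gt0 (a b t : R) : 0 < a * b -> 0 < t -> t != 1 ->
  0 < (1 - t `^ a) * (1 - t `^ b).
Proof.
move=> ab0 t0 t1; rewrite /powR gt_eqF//.
have lt0 : ln t != 0 by rewrite ln_eq0.
have uv0 : 0 < (a * ln t) * (b * ln t).
  have -> : (a * ln t) * (b * ln t) = (a * b) * (ln t) ^+ 2 by ring.
  by rewrite mulr_gt0// exprn_even_gt0.
have [u0|u0|u0] := ltgtP (a * ln t) 0; last by rewrite u0 mul0r ltxx in uv0.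
  rewrite nmulr_rgt0// in uv0.
  by rewrite mulr_gt0// subr_gt0 expR_lt1.
rewrite pmulr_rgt0// in uv0.
by rewrite nmulr_rgt0 subr_lt0 expR_gt1.
Qed.

Lemma powR_weight_ge0 (a b t : R) : 0 < a * b -> 0 < t ->
  0 <= (1 - t `^ a) * (1 - t `^ b).
Proof.
move=> ab0 t0; have [->|t1] := eqVneq t 1; first by rewrite powR1 subrr mul0r.
exact/ltW/powR_weight_gt0.
Qed.

(** Each factor lies between 0 and 1 - t because the exponents are at most 1. The resulting double
    zero at t = 1 compensates the diagonal singularity of the kernel. *)
Lemma powR_weight_le_pos (a b t : R) : 0 < a <= 1 -> 0 < b <= 1 -> 0 < t < 1 ->
  (1 - t `^ a) * (1 - t `^ b) <= (1 - t) ^+ 2.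
Proof.
move=> /andP[a0 a1] /andP[b0 b1] /andP[t0 t1].
have ht r : 0 < r -> r <= 1 -> 0 <= 1 - t `^ r <= 1 - t.
  move=> r0 r1; rewrite lerD2l lerN2 ger1_powR ?t0 ?(ltW t1)// andbT subr_ge0.
  by rewrite -(powRr0 t) ger_powR ?t0 ?ltW.
have /andP[? ?] := ht _ a0 a1; have /andP[? ?] := ht _ b0 b1.
by rewrite expr2 ler_pM.
Qed.

(** Taking t^a and t^b out of the factors leaves the positive exponents -a and -b. *)
Lemma powR_weight_le_neg (a b t : R) : -1 <= a < 0 -> -1 <= b < 0 -> 0 < t < 1 ->
  (1 - t `^ a) * (1 - t `^ b) <= t `^ (a + b) * (1 - t) ^+ 2.
Proof.
move=> /andP[a1 a0] /andP[b1 b0] /andP[t0 t1].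
rewrite powRD ?lt0r_neq0 ?implybT//.
have E r : 1 - t `^ r = - (t `^ r * (1 - t `^ (- r))).
  by rewrite powRN mulrBr mulr1 mulfV ?opprB// powR_eq0 negb_and gt_eqF.
rewrite (E a) (E b) mulrNN mulrACA ler_pM2l ?mulr_gt0 ?powR_gt0//.
by apply: powR_weight_le_pos; rewrite ?t0//; apply/andP; split; lra.
Qed.

(** Near 1 the double zero of the weight leaves (1 - t)^(1-alpha), integrable because alpha < 2;
    near 0 the worst factor is t^(a+b) = t^(alpha-1), integrable because alpha > 0. The sign of
    alpha - 1 decides which end is singular. *)
Lemma powR_weight_integral_lty (alpha a b c : R) (g : R -> \bar R) :
  0 < alpha -> alpha < 2 -> a + b = alpha - 1 -> 0 < a * b ->
  `|a| <= 1 -> `|b| <= 1 -> 0 < c ->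
  measurable_fun [set: R] g -> (forall t, (0 <= g t)%E) ->
  (forall t, 0 < t < 1 -> (g t <= (c * (1 - t) `^ (- alpha - 1))%:E)%E) ->
  (\int[mu]_(t in `]0%R, 1%R[) (((1 - t `^ a) * (1 - t `^ b))%:E * g t) < +oo)%E.
Proof.
move=> al0 al2 abE ab0 a1 b1 c0 mg g0 gc.
pose w t := (1 - t `^ a) * (1 - t `^ b).
pose f t : \bar R := if (0 < t) && (t < 1) then ((w t)%:E * g t)%E else 0%E.
have f0 t : (0 <= f t)%E.
  rewrite /f; case: ifPn => // /andP[t0 _]; rewrite mule_ge0// lee_fin.
  exact: powR_weight_ge0.
have mf : measurable_fun [set: R] f.
  apply: measurable_fun_ifT => //.
    by apply: measurable_and; apply: measurable_fun_ltr.
  apply: emeasurable_funM => //; apply/measurable_EFinP.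
  by apply: measurable_funM; apply: measurable_funB => //; exact: measurable_powR.
rewrite (@integral_if _ _ (fun t => (0 < t) && (t < 1))); last first.
  by move=> t; rewrite set_itvE/=.
rewrite -/f; have [al1|al1] := ltP 1 alpha.
  have [a0 b0] : 0 < a /\ 0 < b.
    by have [a0|a0] := ltP 0 a; [split=> //|]; nra.
  (* For alpha > 1 only the end t = 1 is singular; the reflection t -> 1 - t moves it to 0, where
     [integral_powR_lty] applies. *)
  rewrite (@ge0_integral_affine _ (-1) 1)//.
  rewrite normrN1 mul1e.
  pose F t := f (-1 * t + 1).
  have mF : measurable_fun [set: R] F.
    by apply: (measurableT_comp mf); apply: measurable_funD => //; exact: measurable_funM.
  rewrite (_ : (\int[_]_x _)%E = (\int[mu]_(t in `]0%R, +oo[) F t)%E); last first.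
    rewrite [RHS](@integral_if _ _ (fun t => 0 < t)); last by move=> t; rewrite set_itvE/=.
    apply: eq_integral => t _; case: (ltP 0 t) => // t0.
    by rewrite /f [X in _ && X](_ : _ = false) ?andbF//; apply/negP; lra.
  (* The integrand vanishes beyond 1, so -2 is just some exponent below -1. *)
  apply: (@integral_powR_lty _ _ c (1 - alpha) (- 2)) => //;
    [exact: ltW|lra|lra|by move=> t; exact: f0|..].
  - move=> t /andP[t0 t1]; rewrite /F /f.
    case: ifPn => [/andP[u0 u1]|_]; last by rewrite lee_fin mulr_ge0 ?powR_ge0// ltW.
    have H := powR_weight_le_pos a b (-1 * t + 1).
    apply: (@le_trans _ _ (((1 - (-1 * t + 1)) ^+ 2)%:E *
      (c * (1 - (-1 * t + 1)) `^ (- alpha - 1))%:E)%E).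
      apply: lee_pmul => //; rewrite ?lee_fin ?powR_weight_ge0//; last first.
        by apply: gc; rewrite u0.
      by apply: H; rewrite ?u0 ?a0 ?b0//= -1?(ger0_norm (ltW a0)) -1?(ger0_norm (ltW b0)).
    rewrite -EFinM lee_fin mulrCA ler_pM2l//.
    have -> : 1 - (-1 * t + 1) = t by ring.
    rewrite -(powR_mulrn _ (ltW t0)) -powRD ?lt0r_neq0 ?implybT//.
    by rewrite le_eqVlt; apply/orP; left; apply/eqP; congr powR; lra.
  - move=> t t1; rewrite /F /f ifF; last by apply/negP => /andP[]; lra.
    by rewrite lee_fin mulr_ge0 ?powR_ge0// ltW.
(* Now a + b <= 0 and ab > 0 force both exponents to be negative; (1 - t)^(1-alpha) is at most 1 and
   only t = 0 is singular. *)
have [a0 b0] : a < 0 /\ b < 0.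
  by have [a0|a0] := ltP a 0; [split=> //|]; nra.
rewrite (_ : (\int[_]_x _)%E = (\int[mu]_(t in `]0%R, +oo[) f t)%E); last first.
  rewrite [RHS](@integral_if _ _ (fun t => 0 < t)); last by move=> t; rewrite set_itvE/=.
  by apply: eq_integral => t _; rewrite /f; case: (ltP 0 t).
apply: (@integral_powR_lty _ _ c (alpha - 1) (- 2)) => //; [exact: ltW|lra|lra|..].
- move=> t /andP[t0 _]; rewrite /f t0/=.
  case: ifPn => [t1|_]; last by rewrite lee_fin mulr_ge0 ?powR_ge0// ltW.
  apply: (@le_trans _ _ ((t `^ (a + b) * (1 - t) ^+ 2)%:E * (c * (1 - t) `^ (- alpha - 1))%:E)%E).
    apply: lee_pmul => //; rewrite ?lee_fin ?powR_weight_ge0//; last first.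
      by apply: gc; rewrite t0.
    by apply: powR_weight_le_neg; rewrite ?t0 ?a0 ?b0 ?andbT//=;
      move: a1 b1; rewrite !ltr0_norm//; lra.
  rewrite -EFinM lee_fin abE mulrCA ler_pM2l// -mulrA ler_piMr ?powR_ge0//.
  have u0 : 0 < 1 - t by lra.
  rewrite -(powR_mulrn _ (ltW u0)) -powRD ?lt0r_neq0 ?implybT//.
  rewrite -[leRHS](powRr0 (1 - t)); apply: ger_powR; last by lra.
  by rewrite u0/=; lra.
- move=> t t1; rewrite /f ifF; last by apply/negP => /andP[]; lra.
  by rewrite lee_fin mulr_ge0 ?powR_ge0// ltW.
Qed.

End PowerWeights.

(** * Moments of a homogeneous kernel between the two half-lines *)

Section HomogeneousKernel.
Context {R : realType}.
Local Notation mu := (@lebesgue_measure R).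
Variables (alpha : R) (k : R -> R -> \bar R).
Hypothesis hk : hom_kernel alpha k.

Let k0 x y : (0 <= k x y)%E := hom_kernel_ge0 hk x y.

Lemma measurable_kernel1 x : measurable_fun [set: R] (k x).
Proof.
exact: (measurableT_comp (hom_kernel_measurable hk) (measurable_pair1 x)).
Qed.

Lemma measurable_kernelN x : measurable_fun [set: R] (fun t => k x (- t)).
Proof. exact: (measurableT_comp (measurable_kernel1 x)). Qed.

Lemma measurable_powR_kernel (f : R -> \bar R) s : measurable_fun [set: R] f ->
  measurable_fun [set: R] (fun t => (t `^ s)%:E * f t)%E.
Proof.
move=> mf; apply: emeasurable_funM => //.
by apply/measurable_EFinP; exact: measurable_powR.
Qed.

Lemma kernel_inv x t : 0 < t ->
  k x (t `^ (-1)) = ((t `^ (alpha + 1))%:E * k 1 (x * t))%E.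
Proof.
move=> t0; have ti0 : 0 < t^-1 by rewrite invr_gt0.
have E : x = t^-1 * (x * t) by rewrite mulrCA mulVf ?mulr1// lt0r_neq0.
rewrite powR_inv1 ?ltW// (hom_kernel_sym hk) {1}E -{1}(mulr1 t^-1).
rewrite (hom_kernel_scale hk)//; congr (_%:E * _)%E.
by rewrite -(powR_inv1 (ltW t0)) -powRrM; congr powR; lra.
Qed.

(** This is I_rho of the overview; the moments of k(-1, t) are all expressed through it. *)
Definition cross_moment (rho : R) : \bar R :=
  (\int[mu]_(t in `]0%R, +oo[) ((t `^ rho)%:E * k 1%R (- t)%R))%E.

Lemma cross_moment_ge0 rho : (0 <= cross_moment rho)%E.
Proof. by apply: integral_ge0 => t _; rewrite mule_ge0// lee_fin powR_ge0. Qed.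

(** Under t -> 1/t the power t^rho becomes t^(-rho), the Jacobian contributes t^-2 and homogeneity
    t^(alpha+1); the exponents add up to alpha - 1 - rho. *)
Lemma cross_moment_inv rho :
  (\int[mu]_(t in `]0%R, +oo[) ((t `^ rho)%:E * k (-1)%R t))%E =
  cross_moment (alpha - 1 - rho).
Proof.
rewrite ge0_integral_powRN1; last 2 first.
- by apply: measurable_powR_kernel; exact: measurable_kernel1.
- by move=> t; rewrite mule_ge0// lee_fin powR_ge0.
apply: eq_integral => t; rewrite inE/= in_itv/= andbT => t0.
rewrite kernel_inv// mulN1r !muleA -!EFinM -powRrM mulN1r.
rewrite -powRD ?lt0r_neq0 ?implybT// -powRD ?lt0r_neq0 ?implybT//.
by congr (_%:E * _)%E; congr powR; lra.
Qed.

Lemma kernel_cross_bound : exists c, 0 < c /\ forall t, 0 < t ->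
  (k 1 (- t) <= (c * (1 + t) `^ (- alpha - 1))%:E)%E.
Proof.
have [c [c0 kc]] := hom_kernel_bound hk; exists c; split => // t t0.
apply: (le_trans (kc _ _ _)); first by rewrite eq_sym lt_eqF//; lra.
by rewrite opprK gtr0_norm//; lra.
Qed.

(** The points 1 and -t are at distance 1 + t, so the kernel has no singularity here: it is bounded
    near 0, where rho > -1 is used, and at most c t^(-alpha-1) at infinity, where rho < alpha is
    used. *)
Lemma cross_moment_lty rho : -1 < rho -> rho < alpha -> (cross_moment rho < +oo)%E.
Proof.
move=> r1 r2; have [c [c0 kc]] := kernel_cross_bound.
apply: (@integral_powR_lty _ _ c rho (rho - alpha - 1)) => //; [exact: ltW|lra|..].
- by apply: measurable_powR_kernel; exact: measurable_kernelN.
- by move=> t; rewrite mule_ge0// lee_fin powR_ge0.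
- move=> t /andP[t0 t1]; rewrite mulrC EFinM lee_wpmul2l ?lee_fin ?powR_ge0//.
  apply: (le_trans (kc _ t0)); rewrite lee_fin ler_piMr ?(ltW c0)//.
  rewrite [leRHS](_ : 1 = 1 `^ (- alpha - 1)); last by rewrite powR1.
  by apply: ler_powR_le0 => //; lra.
- move=> t t1; have t0 : 0 < t by lra.
  rewrite -addrA powRD ?lt0r_neq0 ?implybT// mulrCA EFinM.
  rewrite lee_wpmul2l ?lee_fin ?powR_ge0//.
  apply: (le_trans (kc _ t0)); rewrite lee_fin ler_pM2l//.
  by apply: ler_powR_le0 => //; lra.
Qed.

Lemma cross_moment_fin rho : -1 < rho -> rho < alpha ->
  cross_moment rho \is a fin_num.
Proof. by move=> ? ?; rewrite ge0_fin_numE ?cross_moment_ge0// cross_moment_lty. Qed.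

(** Read backwards, this is the source of every strict inequality for irreducible kernels.
    Positivity is asked only almost everywhere because the weight in [moments_gt0] vanishes at one
    point. *)
Lemma reducible_of_integral_eq0 (w : R -> R) : measurable_fun [set: R] w ->
  (forall t, 0 < t -> 0 <= w t) -> {ae mu, forall t, 0 < t -> 0 < w t} ->
  (\int[mu]_(t in `]0%R, +oo[) ((w t)%:E * k (-1)%R t))%E = 0%E -> reducible k.
Proof.
move=> mw w0 wpos iw.
have mf : measurable_fun [set: R] (fun t => (w t)%:E * k (-1)%R t)%E.
  by apply: emeasurable_funM; [exact/measurable_EFinP|exact: measurable_kernel1].
have H := ge0_integral_eq0_ae (measurable_itv _) (measurable_funTS mf) _ iw.
apply: ae_impl2 wpos (H _) => [t wt {}H t0|t]; last first.
  by rewrite set_itvE/= => t0; rewrite mule_ge0// lee_fin w0.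
move: H; rewrite set_itvE/= => /(_ t0)/eqP.
by rewrite mule_eq0 eqe gt_eqF ?wt//= => /eqP.
Qed.

Lemma reducible_cross_moment rho : reducible k -> cross_moment rho = 0%E.
Proof.
move=> red; rewrite [rho](_ : _ = alpha - 1 - (alpha - 1 - rho)); last by lra.
rewrite -cross_moment_inv.
rewrite (ae_eq_integral (cst 0%E))//; first exact: integral0.
- by apply: measurable_funTS; apply: measurable_powR_kernel; exact: measurable_kernel1.
- by apply: ae_impl red => t H; rewrite /= in_itv/= andbT => t0; rewrite H// mule0.
Qed.

End HomogeneousKernel.

Arguments measurable_kernel1 {R alpha k}.
Arguments measurable_kernelN {R alpha k}.
Arguments cross_moment_ge0 {R alpha k}.
Arguments cross_moment_inv {R alpha k}.
Arguments cross_moment_fin {R alpha k}.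
Arguments reducible_of_integral_eq0 {R alpha k}.
Arguments reducible_cross_moment {R alpha k}.

(** * A kernel whose slices at 1 and -1 vanish is null in the plane *)

Section KernelNull.
Context {R : realType}.
Local Notation mu := (@lebesgue_measure R).
Variables (alpha : R) (k : R -> R -> \bar R).
Hypotheses (hk : hom_kernel alpha k).

Let k0 x y : (0 <= k x y)%E := hom_kernel_ge0 hk x y.

Lemma kernel_inv_same e t : 0 < t ->
  k e (e * t `^ (-1)) = ((t `^ (alpha + 1))%:E * k e (e * t))%E.
Proof.
move=> t0; have ti0 : 0 < t^-1 by rewrite invr_gt0.
have E : e = t^-1 * (e * t) by rewrite mulrCA mulVf ?mulr1// lt0r_neq0.
rewrite powR_inv1 ?ltW// (hom_kernel_sym hk) [X in k _ X]E (mulrC e t^-1).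
rewrite (hom_kernel_scale hk)//; congr (_%:E * _)%E.
by rewrite -(powR_inv1 (ltW t0)) -powRrM; congr powR; lra.
Qed.

(** Inversion carries ]1, oo[ onto ]0, 1[, where the kernel is already zero, and t = 1 is a null
    set. *)
Lemma integral_kernel_half_eq0 e :
  {ae mu, forall t, 0 < t < 1 -> k e (e * t) = 0%E} ->
  (\int[mu]_(t in `]0%R, +oo[) k e (e * t) = 0)%E.
Proof.
move=> k1.
have mke : measurable_fun [set: R] (fun t => k e (e * t)).
  have me : measurable_fun [set: R] ( *%R e) by exact: measurable_funM.
  exact: (measurableT_comp (measurable_kernel1 hk e) me).
pose f t : \bar R := if 1 < t then k e (e * t) else 0%E.
have mf : measurable_fun [set: R] f.
  by apply: measurable_fun_ifT => //; exact: measurable_fun_ltr.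
have f0 t : (0 <= f t)%E by rewrite /f; case: ifPn.
have int_f : (\int[mu]_(t in `]0%R, +oo[) f t = 0)%E.
  rewrite ge0_integral_powRN1// (ae_eq_integral (cst 0%E)) ?integral0//.
    apply: measurable_funTS; apply: emeasurable_funM.
      by apply/measurable_EFinP; exact: measurable_powR.
    by apply: (measurableT_comp mf); exact: measurable_powR.
  apply: ae_impl k1 => t H; rewrite /= in_itv/= andbT => t0; rewrite /f.
  case: ifPn => [t1|_]; last by rewrite mule0.
  rewrite kernel_inv_same// H ?mule0//.
  by rewrite t0/=; move: t1; rewrite (powR_inv1 (ltW t0)) invf_gt1.
rewrite (ae_eq_integral (cst 0%E)) ?integral0//; first exact: measurable_funTS.
have := ge0_integral_eq0_ae (measurable_itv _) (measurable_funTS mf) _ int_f.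
move=> /(_ (fun t _ => f0 t)) H.
apply: ae_impl2 (ae_impl2 (fun t a b => conj a b) k1 H) (ae_neq 1).
move=> t [H1 H2] t1; rewrite /= in_itv/= andbT => t0.
move: H2; rewrite set_itvE/= /f => /(_ t0).
have [//|t2 _] := ltP 1 t.
by apply: H1; rewrite t0 lt_neqAle t1.
Qed.

(** The four hypotheses account for the four quadrants. They make the slices at 1 and -1 null,
    homogeneity spreads this to every x != 0, and Tonelli concludes. *)
Lemma kernel_ae0_of_slices :
  {ae mu, forall t, 0 < t < 1 -> k 1 t = 0%E} ->
  {ae mu, forall t, 0 < t < 1 -> k (-1) (- t) = 0%E} ->
  (\int[mu]_(t in `]0%R, +oo[) k 1 (- t)%R = 0)%E ->
  (\int[mu]_(t in `]0%R, +oo[) k (-1)%R t = 0)%E ->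
  kernel_ae0 k.
Proof.
move=> kp km ip im.
have slice e : e = 1 \/ e = -1 -> (\int[mu]_t k e t = 0)%E.
  move=> he; rewrite ge0_integral_halves//; last exact: (measurable_kernel1 hk).
  case: he => ->.
    rewrite ip adde0 -[RHS](@integral_kernel_half_eq0 1).
      by apply: eq_integral => t _; rewrite mul1r.
    by apply: ae_impl kp => t; rewrite mul1r.
  rewrite im add0e -[RHS](@integral_kernel_half_eq0 (-1)).
    by apply: eq_integral => t _; rewrite mulN1r.
  by apply: ae_impl km => t; rewrite mulN1r.
(* Scaling by |x| reduces the slice at [x] to the one at the sign of [x]. *)
have slicex x : x != 0 -> (\int[mu]_y k x y = 0)%E.
  move=> x0; have nx0 : 0 < `|x| by rewrite normr_gt0.
  rewrite (@ge0_integral_affine _ `|x| 0) ?gt_eqF//; last exact: (measurable_kernel1 hk).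
  rewrite (_ : (\int[_]_y _)%E = (\int[mu]_y ((`|x| `^ (- alpha - 1))%:E * k (Num.sg x) y))%E).
    rewrite ge0_integralZl//; last exact: (measurable_kernel1 hk).
    rewrite slice ?mule0//.
    by have [?|?] := ltP 0 x; [left; rewrite gtr0_sg|right; rewrite ltr0_sg// lt_neqAle x0].
  apply: eq_integral => y _; rewrite addr0 {1}(numEsg x) mulrC.
  by rewrite (hom_kernel_scale hk).
have int0 : (\int[mu \x mu]_z k z.1 z.2 = 0)%E.
  rewrite [LHS](@fubini_tonelli1 _ _ _ _ R mu mu (fun z => k z.1 z.2))//;
    last exact: hom_kernel_measurable hk.
  rewrite /fubini_F/= (ae_eq_integral (cst 0%E)) ?integral0//.
  - have mF := @measurable_fun_fubini_tonelli_F _ _ _ _ R mu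
      (fun z => k z.1 z.2) (hom_kernel_measurable hk).
    by apply: mF => z; exact: k0.

  - exists [set 0]; split; [exact: measurable_set1|exact: lebesgue_measure_set1|].
    move=> x /=; apply: contra_notP => /eqP x0 _; exact: slicex.
have H : ae_eq (mu \x mu)%E setT (fun z => k z.1 z.2) (cst 0%E).
  apply/(@ae_eq_integral_abs _ _ _ (mu \x mu)%E setT measurableT _
    (hom_kernel_measurable hk)).
  by rewrite -[RHS]int0; apply: eq_integral => z _; rewrite gee0_abs.
move: H; apply: (@filterS _ _ (ae_filter_ringOfSetsType (mu \x mu)%E)) => z.
exact.
Qed.

End KernelNull.

Arguments kernel_ae0_of_slices {R alpha k}.

(** * A real-variable argument for the point where both constants agree *)

Section BalancedPoint.
Context {R : realType}.
Variables (P Q m0 m1 ma mb gp gm : R).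
Hypotheses (P0 : 0 < P) (Q0 : 0 < Q) (PQ : P + Q = 1).
Hypotheses (ma0 : 0 < ma) (mb0 : 0 < mb) (gp0 : 0 <= gp) (gm0 : 0 <= gm).
Hypothesis moments_gt0 : forall s, 0 < s ->
  0 < m0 + s * m1 - s `^ Q * ma - s `^ P * mb.

(** [dp] and [dm] are the real values of D_+ and D_-, with [P] = 1/p, [Q] = 1/q and with [m0], [m1],
    [ma], [mb] the cross moments of orders 0, alpha - 1, a and b. *)
Let dp s := gp + m0 - (P * s `^ Q * ma + Q * s `^ P * mb).
Let dm s := gm + m1 - (P * s `^ (- Q) * mb + Q * s `^ (- P) * ma).

(** Multiplication by s turns s^(-Q) into s^P and s^(-P) into s^Q; equal powers then carry the total
    coefficient P + Q = 1, which is the form of [moments_gt0]. *)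
Let Dpm_combination_gt0 s : 0 < s -> 0 < dp s + s * dm s.
Proof.
move=> s0; have := moments_gt0 _ s0.
have sE r : s * s `^ (- r) = s `^ (1 - r) by rewrite mulr_powRD1// addrC.
have pE : 1 - P = Q by have := PQ; lra.
have qE : 1 - Q = P by have := PQ; lra.
have -> : dp s + s * dm s = (gp + s * gm) + (m0 + s * m1)
  - (P * s `^ Q * ma + Q * s `^ P * mb)
  - (P * (s * s `^ (- Q)) * mb + Q * (s * s `^ (- P)) * ma).
  by rewrite /dp /dm; ring.
rewrite !sE pE qE => H.
have H2 : 0 <= gp + s * gm by rewrite addr_ge0// mulr_ge0// ltW.
have -> : gp + s * gm + (m0 + s * m1)
  - (P * s `^ Q * ma + Q * s `^ P * mb)
  - (P * s `^ P * mb + Q * s `^ Q * ma) =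
  (gp + s * gm) + (m0 + s * m1 - (P + Q) * (s `^ Q * ma)
   - (P + Q) * (s `^ P * mb)) by ring.
rewrite PQ !mul1r; exact: ltr_wpDl H2 H.
Qed.

Let continuous_dp s : 0 < s -> {for s, continuous dp}.
Proof.
move=> s0; apply: cvgB; first exact: cvg_cst.
by apply: cvgD; apply: cvgMl; apply: cvgMr; exact: continuous_powR_gt0.
Qed.

Let continuous_dm s : 0 < s -> {for s, continuous dm}.
Proof.
move=> s0; apply: cvgB; first exact: cvg_cst.
by apply: cvgD; apply: cvgMl; apply: cvgMr; exact: continuous_powR_gt0.
Qed.

Let dp_large : exists s, 1 <= s /\ dp s <= dm s.
Proof.
pose A := gp + m0 - gm - m1; pose B := P * mb + Q * ma.
have B0 : 0 < B by rewrite addr_gt0 ?mulr_gt0.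
(* Taking s^Q = [M] gives P s^Q ma = P ma + |A| + B: enough to beat both the difference [A] of the
   constant terms and [B], which bounds the terms subtracted in [dm] once s >= 1. *)
pose M := 1 + P^-1 * (`|A| + B) / ma.
have M1 : 1 <= M.
  rewrite lerDl divr_ge0 ?(ltW ma0)// mulr_ge0 ?invr_ge0 ?(ltW P0)//.
  by rewrite addr_ge0// ltW.
have s1 : 1 <= M `^ Q^-1.
  by rewrite -[leLHS](powRr0 M) ler_powR// invr_ge0 ltW.
exists (M `^ Q^-1); split => //.
set s := _ `^ _ in s1 *.
have sM : s `^ Q = M by rewrite /s -powRrM mulVf ?gt_eqF// powRr1// (le_trans ler01).
have sN r : 0 <= r -> s `^ (- r) <= 1.
  by move=> r0; rewrite -[leRHS](powRr0 s) ler_powR// oppr_le0.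
have h1 : P * s `^ (- Q) * mb <= P * mb.
  by rewrite ler_pM2r//; apply: ler_piMr; [exact: ltW|apply: sN; exact: ltW].
have h2 : Q * s `^ (- P) * ma <= Q * ma.
  by rewrite ler_pM2r//; apply: ler_piMr; [exact: ltW|apply: sN; exact: ltW].
have h3 : 0 <= Q * s `^ P * mb.
  by rewrite mulr_ge0 ?(ltW ma0) ?(ltW mb0)// mulr_ge0 ?powR_ge0// ltW.
have h4 : P * s `^ Q * ma = P * ma + (`|A| + B).
  by rewrite sM /M; field; rewrite !gt_eqF.
have h5 : 0 < P * ma by rewrite mulr_gt0.
have h6 : A <= `|A| by exact: ler_norm.
by rewrite /dp /dm h4; rewrite /A /B in h6 *; lra.
Qed.

(** Mirror image of [dp_large] under s -> 1/s, which exchanges the two half-lines together with [ma]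
    and [mb]. *)
Let dp_small : exists s, [/\ 0 < s, s <= 1 & dm s <= dp s].
Proof.
pose A := gm + m1 - gp - m0; pose B := P * ma + Q * mb.
have B0 : 0 < B by rewrite addr_gt0 ?mulr_gt0.
pose M := 1 + P^-1 * (`|A| + B) / mb.
have M1 : 1 <= M.
  rewrite lerDl divr_ge0 ?(ltW mb0)// mulr_ge0 ?invr_ge0 ?(ltW P0)//.
  by rewrite addr_ge0// ltW.
have M0 : 0 < M by rewrite (lt_le_trans ltr01).
have s1 : M `^ (- Q^-1) <= 1.
  by rewrite -[leRHS](powRr0 M) ler_powR// oppr_le0 invr_ge0 ltW.
exists (M `^ (- Q^-1)); split => //; first exact: powR_gt0.
have s0 : 0 < M `^ (- Q^-1) by exact: powR_gt0.
set s := _ `^ _ in s0 s1 *.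
have sM : s `^ (- Q) = M.
  by rewrite /s -powRrM mulrNN mulVf ?gt_eqF// powRr1// ltW.
have sN r : 0 <= r -> s `^ r <= 1.
  by move=> r0; rewrite -[leRHS](powRr0 s) ger_powR// s0.
have h1 : P * s `^ Q * ma <= P * ma.
  by rewrite ler_pM2r//; apply: ler_piMr; [exact: ltW|apply: sN; exact: ltW].
have h2 : Q * s `^ P * mb <= Q * mb.
  by rewrite ler_pM2r//; apply: ler_piMr; [exact: ltW|apply: sN; exact: ltW].
have h3 : 0 <= Q * s `^ (- P) * ma.
  by rewrite mulr_ge0 ?(ltW ma0) ?(ltW mb0)// mulr_ge0 ?powR_ge0// ltW.
have h4 : P * s `^ (- Q) * mb = P * mb + (`|A| + B).
  by rewrite sM /M; field; rewrite !gt_eqF.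
have h5 : 0 < P * mb by rewrite mulr_gt0.
have h6 : A <= `|A| by exact: ler_norm.
by rewrite /dp /dm h4; rewrite /A /B in h6 *; lra.
Qed.

Lemma balanced_point : exists s0, [/\ 0 < s0, dp s0 = dm s0, 0 < dp s0 &
  \forall s \near s0, [/\ 0 < s, 0 < dp s & 0 < dm s]].
Proof.
have [s1 [s11 d1]] := dp_large; have [s2 [s20 s21 d2]] := dp_small.
have [||s] := @IVT R (fun s => dp s - dm s) s2 s1 0 (le_trans s21 s11).
- apply: continuous_in_subspaceT => s; rewrite inE/= in_itv/= => /andP[s2s _].
  have s0 := lt_le_trans s20 s2s.
  by apply: cvgB; [exact: continuous_dp|exact: continuous_dm].
- by rewrite ge_min le_max !subr_le0 !subr_ge0 d1 d2 orbT.
rewrite in_itv/= => /andP[s2s _] /eqP; rewrite subr_eq0 => /eqP dE.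
have s0 := lt_le_trans s20 s2s.
have ds0 : 0 < dp s.
  (* With equal values the positive combination is (1 + s) dp s. *)
  have := Dpm_combination_gt0 _ s0; rewrite -dE -{1}(mul1r (dp s)) -mulrDl.
  by rewrite pmulr_rgt0//; lra.
exists s; split => //.
have h1 : \forall s' \near s, 0 < dp s' by exact: (cvgr_gt _ (continuous_dp _ s0)).
have h2 : \forall s' \near s, 0 < dm s'.
  by apply: (cvgr_gt _ (continuous_dm _ s0)); rewrite -dE.
by near=> s'; split; near: s' => //; exact: lt_nbhsr.
Unshelve. all: by end_near. Qed.

End BalancedPoint.

(** * The constants D_+ and D_-, and the proofs of (b) and (c) *)

Section HardyConstants.
Context {R : realType}.
Local Notation mu := (@lebesgue_measure R).
Variables (alpha p : R) (k : R -> R -> \bar R).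
Hypotheses (hp : 1 < p) (al0 : 0 < alpha) (al2 : alpha < 2) (al1 : alpha != 1).
Hypothesis hk : hom_kernel alpha k.

Local Notation q := (conj_exp p).
Local Notation a := ((alpha - 1) / q).
Local Notation b := ((alpha - 1) / p).

Let k0 x y : (0 <= k x y)%E := hom_kernel_ge0 hk x y.

Let p0 : 0 < p. Proof. exact: lt_trans hp. Qed.

Lemma conj_exp_invD : p^-1 + q^-1 = 1.
Proof.
by rewrite /conj_exp invf_div -{1}(mul1r p^-1) -mulrDl addrCA subrr addr0 mulfV ?gt_eqF.
Qed.

Lemma invp_bounds : 0 < p^-1 < 1.
Proof. by rewrite invr_gt0 p0 invf_lt1. Qed.

Lemma invq_bounds : 0 < q^-1 < 1.
Proof. by have := invp_bounds; have := conj_exp_invD; lra. Qed.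

Let abE : a + b = alpha - 1.
Proof. by rewrite -mulrDr (addrC q^-1) conj_exp_invD mulr1. Qed.

Let subaE : alpha - 1 - a = b.
Proof. by rewrite -[X in X - a]abE addrAC subrr add0r. Qed.

Let subbE : alpha - 1 - b = a.
Proof. by rewrite -[X in X - b]abE addrK. Qed.

Let beta0 : alpha - 1 != 0. Proof. by rewrite subr_eq0. Qed.

Let ab0 : 0 < a * b.
Proof.
rewrite mulrACA -expr2 mulr_gt0 ?exprn_even_gt0//.
by have /andP[? _] := invp_bounds; have /andP[? _] := invq_bounds; exact: mulr_gt0.
Qed.

Lemma exponent_bounds (c : R) : 0 < c < 1 ->
  [/\ `|(alpha - 1) * c| <= 1, -1 < (alpha - 1) * c & (alpha - 1) * c < alpha].
Proof.
move=> /andP[c0 c1]; have [a0 a2] := (al0, al2).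
(* The three products supply the nonlinear facts; after them [alpha * c] is an atom for [lra]. *)
have h1 : 0 < (1 + (alpha - 1)) * c by apply: mulr_gt0 => //; lra.
have h2 : 0 < (1 - (alpha - 1)) * c by apply: mulr_gt0 => //; lra.
have h3 : 0 < (1 + (alpha - 1)) * (1 - c) by apply: mulr_gt0; lra.
have E : (alpha - 1) * c = alpha * c - c by ring.
have {}h1 : 0 < alpha * c by move: h1; rewrite addrC subrK.
have {}h2 : alpha * c < 2 * c by move: h2; rewrite mulrBl mul1r E; lra.
have {}h3 : alpha * c < alpha by move: h3; rewrite (addrC 1) subrK mulrBr mulr1; lra.
by rewrite E ler_norml; split; [apply/andP; split|..]; lra.
Qed.

Lemma gamma_plusE : gamma_plus alpha k a =
  (\int[mu]_(t in `]0%R, 1%R[) (((1 - t `^ a) * (1 - t `^ b))%:E * k 1%R t))%E.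
Proof. by rewrite /gamma_plus; congr integral; apply/funext => t; rewrite subaE. Qed.

(** Passing from rho to alpha - 1 - rho swaps the two factors of the weight, and b = alpha - 1 - a.
    Hence both halves of D_+ contain the same gamma, with total coefficient 1/p + 1/q = 1. *)
Lemma gamma_plus_sym : gamma_plus alpha k b = gamma_plus alpha k a.
Proof.
rewrite gamma_plusE /gamma_plus; congr integral; apply/funext => t.
by rewrite subbE mulrC.
Qed.

Lemma gamma_minusE : gamma_minus alpha k a =
  (\int[mu]_(t in `]0%R, 1%R[) (((1 - t `^ a) * (1 - t `^ b))%:E * k (-1)%R (- t)%R))%E.
Proof. by rewrite /gamma_minus; congr integral; apply/funext => t; rewrite subaE. Qed.

Lemma gamma_minus_sym : gamma_minus alpha k b = gamma_minus alpha k a.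
Proof.
rewrite gamma_minusE /gamma_minus; congr integral; apply/funext => t.
by rewrite subbE mulrC.
Qed.

Let weight_int_ge0 (g : R -> \bar R) : (forall t, 0 <= g t)%E ->
  (0 <= \int[mu]_(t in `]0%R, 1%R[) (((1 - t `^ a) * (1 - t `^ b))%:E * g t))%E.
Proof.
move=> g0; apply: integral_ge0 => t /=; rewrite in_itv/= => /andP[t0 _].
by rewrite mule_ge0// lee_fin powR_weight_ge0.
Qed.

Let weight_int_eq0 (g : R -> \bar R) : measurable_fun [set: R] g ->
  (forall t, 0 <= g t)%E ->
  (\int[mu]_(t in `]0%R, 1%R[) (((1 - t `^ a) * (1 - t `^ b))%:E * g t) = 0)%E ->
  {ae mu, forall t, 0 < t < 1 -> g t = 0%E}.
Proof.
move=> mg g0 ig.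
have mw : measurable_fun [set: R] (fun t => ((1 - t `^ a) * (1 - t `^ b))%:E * g t)%E.
  apply: emeasurable_funM => //; apply/measurable_EFinP.
  by apply: measurable_funM; apply: measurable_funB => //; exact: measurable_powR.
have H := ge0_integral_eq0_ae (measurable_itv _) (measurable_funTS mw) _ ig.
apply: ae_impl (H _) => [t {}H t01|t]; last first.
  rewrite set_itvE/= => /andP[t0 _].
  by rewrite mule_ge0// lee_fin powR_weight_ge0.
move: H; rewrite set_itvE/= => /(_ t01)/eqP.
have /andP[t0 t1] := t01.
have t1' : t != 1 by rewrite lt_eqF.
by rewrite mule_eq0 eqe (gt_eqF (powR_weight_gt0 _ _ _ ab0 t0 t1'))/= => /eqP.
Qed.

Lemma gamma_plus_ge0 : (0 <= gamma_plus alpha k a)%E.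
Proof. by rewrite gamma_plusE; apply: weight_int_ge0 => t; exact: k0. Qed.

Lemma gamma_minus_ge0 : (0 <= gamma_minus alpha k a)%E.
Proof. by rewrite gamma_minusE; apply: weight_int_ge0 => t; exact: k0. Qed.

Lemma gamma_plus_eq0 : gamma_plus alpha k a = 0%E ->
  {ae mu, forall t, 0 < t < 1 -> k 1 t = 0%E}.
Proof.
by rewrite gamma_plusE; apply: weight_int_eq0 => //; exact: (measurable_kernel1 hk).
Qed.

Lemma gamma_minus_eq0 : gamma_minus alpha k a = 0%E ->
  {ae mu, forall t, 0 < t < 1 -> k (-1) (- t) = 0%E}.
Proof.
by rewrite gamma_minusE; apply: weight_int_eq0 => //; exact: (measurable_kernelN hk).
Qed.

Let ab_norm : `|a| <= 1 /\ `|b| <= 1.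
Proof.
by have [? _ _] := exponent_bounds _ invp_bounds; have [? _ _] := exponent_bounds _ invq_bounds.
Qed.

Lemma gamma_plus_fin : gamma_plus alpha k a \is a fin_num.
Proof.
rewrite ge0_fin_numE ?gamma_plus_ge0// gamma_plusE.
have [c [c0 kc]] := hom_kernel_bound hk; have [? ?] := ab_norm.
apply: (@powR_weight_integral_lty _ alpha _ _ c) => //.
  exact: (measurable_kernel1 hk).
move=> t /andP[t0 t1]; rewrite -(@ger0_norm _ (1 - t)); last by lra.
by apply: kc; rewrite gt_eqF.
Qed.

Lemma gamma_minus_fin : gamma_minus alpha k a \is a fin_num.
Proof.
rewrite ge0_fin_numE ?gamma_minus_ge0// gamma_minusE.
have [c [c0 kc]] := hom_kernel_bound hk; have [? ?] := ab_norm.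
apply: (@powR_weight_integral_lty _ alpha _ _ c) => //.
  exact: (measurable_kernelN hk).
move=> t /andP[t0 t1].
have -> : 1 - t = `|-1 - - t| by rewrite ltr0_norm; lra.
by apply: kc; rewrite eqr_opp gt_eqF.
Qed.

Lemma C_plusE r rho : C_plus alpha k r rho =
  (gamma_plus alpha k rho + cross_moment k 0 - r%:E * cross_moment k rho)%E.
Proof.
rewrite /C_plus -/(cross_moment k rho); congr (_ + _ - _)%E.
by apply: eq_integral => t _; rewrite powRr0 mul1e.
Qed.

Lemma C_minusE r rho : C_minus alpha k r rho =
  (gamma_minus alpha k rho + cross_moment k (alpha - 1)
   - (r^-1)%:E * cross_moment k (alpha - 1 - rho))%E.
Proof.
rewrite /C_minus -(cross_moment_inv hk); congr (_ + _ - _)%E.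
rewrite -[X in cross_moment _ X]subr0 -(cross_moment_inv hk).
by apply: eq_integral => t _; rewrite powRr0 mul1e.
Qed.

Let convex_comb (x : \bar R) : (0 <= x)%E -> ((p^-1)%:E * x + (q^-1)%:E * x = x)%E.
Proof.
move=> x0; have /andP[P0 _] := invp_bounds; have /andP[Q0 _] := invq_bounds.
by rewrite -ge0_muleDl ?lee_fin ?(ltW P0) ?(ltW Q0)// -EFinD conj_exp_invD mul1e.
Qed.

Lemma D_plus_reducible s : reducible k ->
  D_plus alpha k p s (alpha - 1) = gamma_plus alpha k a.
Proof.
move=> red; rewrite /D_plus !C_plusE !(reducible_cross_moment hk)// !mule0.
by rewrite gamma_plus_sym sube0 adde0 convex_comb// gamma_plus_ge0.
Qed.

Lemma D_minus_reducible s : reducible k ->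
  D_minus alpha k p s (alpha - 1) = gamma_minus alpha k a.
Proof.
move=> red; rewrite /D_minus !C_minusE !(reducible_cross_moment hk)// !mule0.
by rewrite gamma_minus_sym sube0 adde0 convex_comb// gamma_minus_ge0.
Qed.

(** As the weights are positive on ]0, 1[, vanishing gammas kill the kernel on the two quadrants of
    equal signs; reducibility kills it on the mixed ones. This yields the strict positivity on a
    half-line in (b). *)
Lemma reducible_gamma_eq0 : reducible k -> gamma_plus alpha k a = 0%E ->
  gamma_minus alpha k a = 0%E -> kernel_ae0 k.
Proof.
move=> red /gamma_plus_eq0 gp /gamma_minus_eq0 gm.
apply: (kernel_ae0_of_slices hk) => //.
  rewrite -(reducible_cross_moment hk 0 red).
  by apply: eq_integral => t _; rewrite powRr0 mul1e.
rewrite -(reducible_cross_moment hk (alpha - 1 - 0) red) -(cross_moment_inv hk).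
by apply: eq_integral => t _; rewrite powRr0 mul1e.
Qed.

Lemma hardy_W_reducible : reducible k -> ~ kernel_ae0 k ->
  (forall s s' x : R, 0 < s -> 0 < s' -> x != 0 ->
     hardy_W alpha k p s x = hardy_W alpha k p s' x)
  /\ (forall s x : R, 0 < s -> x != 0 -> (0 <= hardy_W alpha k p s x)%E)
  /\ ((forall s x : R, 0 < s -> 0 < x -> (0 < hardy_W alpha k p s x)%E)
      \/ (forall s x : R, 0 < s -> x < 0 -> (0 < hardy_W alpha k p s x)%E)).
Proof.
move=> red nk0.
have WE s x : hardy_W alpha k p s x = ((`|x| `^ (- alpha))%:E *
    (if (0 < x)%R then gamma_plus alpha k a else gamma_minus alpha k a))%E.
  by rewrite /hardy_W D_plus_reducible// D_minus_reducible.
split; first by move=> s s' x _ _ _; rewrite !WE.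
split.
  move=> s x _ _; rewrite WE mule_ge0 ?lee_fin ?powR_ge0//.
  by case: ifPn => _; [exact: gamma_plus_ge0|exact: gamma_minus_ge0].
have [gp|gp] := eqVneq (gamma_plus alpha k a) 0%E; last first.
  left=> s x _ x0; rewrite WE x0 mule_gt0 ?lte_fin ?powR_gt0 ?normr_gt0 ?gt_eqF//.
  by rewrite lt0e gp gamma_plus_ge0.
have [gm|gm] := eqVneq (gamma_minus alpha k a) 0%E.
  by case: nk0; exact: reducible_gamma_eq0.
right=> s x _ x0; rewrite WE (lt_gtF x0) mule_gt0 ?lte_fin ?powR_gt0 ?normr_gt0 ?lt_eqF//.
by rewrite lt0e gm gamma_minus_ge0.
Qed.

Lemma integral_crossD (w1 w2 : R -> R) :
  measurable_fun [set: R] w1 -> measurable_fun [set: R] w2 ->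
  (forall t, 0 < t -> 0 <= w1 t) -> (forall t, 0 < t -> 0 <= w2 t) ->
  (\int[mu]_(t in `]0%R, +oo[) ((w1 t + w2 t)%:E * k (-1)%R t) =
   \int[mu]_(t in `]0%R, +oo[) ((w1 t)%:E * k (-1)%R t) +
   \int[mu]_(t in `]0%R, +oo[) ((w2 t)%:E * k (-1)%R t))%E.
Proof.
move=> mw1 mw2 w10 w20.
have mw (w : R -> R) : measurable_fun [set: R] w ->
    measurable_fun (`]0%R, +oo[%classic : set R) (fun t => (w t)%:E * k (-1)%R t)%E.
  move=> m; apply: measurable_funTS; apply: emeasurable_funM.
    exact/measurable_EFinP.
  exact: (measurable_kernel1 hk).
rewrite -ge0_integralD//.
- apply: eq_integral => t; rewrite inE/= in_itv/= andbT => t0.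
  by rewrite EFinD ge0_muleDl// lee_fin ?w10 ?w20.
- by move=> t /=; rewrite in_itv/= andbT => t0; rewrite mule_ge0// lee_fin w10.
- exact: mw.
- by move=> t /=; rewrite in_itv/= andbT => t0; rewrite mule_ge0// lee_fin w20.
- exact: mw.
Qed.

Lemma integral_crossZ (c rho : R) : 0 <= c ->
  (\int[mu]_(t in `]0%R, +oo[) ((c * t `^ rho)%:E * k (-1)%R t) =
   c%:E * cross_moment k (alpha - 1 - rho))%E.
Proof.
move=> c0; rewrite -(cross_moment_inv hk) -ge0_integralZl//; first last.
- by move=> t _; rewrite mule_ge0// lee_fin powR_ge0.
- apply: measurable_funTS; apply: measurable_powR_kernel.
  exact: (measurable_kernel1 hk).
by apply: eq_integral => t _; rewrite EFinM muleA.
Qed.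

Hypothesis irr : irreducible k.

Lemma cross_moment_gt0 rho : (0 < cross_moment k rho)%E.
Proof.
rewrite lt0e (cross_moment_ge0 hk) andbT; apply/eqP => I0; apply: irr.
apply: (reducible_of_integral_eq0 hk (fun t => t `^ (alpha - 1 - rho))).
- exact: measurable_powR.
- by move=> t _; exact: powR_ge0.
- by apply: aeW => t; exact: powR_gt0.
- by rewrite (cross_moment_inv hk) -I0; congr cross_moment; lra.
Qed.

(* t^(alpha-1) + s - s^(1/q) t^b - s^(1/p) t^a = s (1 - z^(1/p)) (1 - z^(1/q))
   with z = t^(alpha-1) / s, positive off z = 1. *)
Lemma moments_gt0 s m0 m1 ma mb : 0 < s ->
  cross_moment k 0 = m0%:E -> cross_moment k (alpha - 1) = m1%:E ->
  cross_moment k a = ma%:E -> cross_moment k b = mb%:E ->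
  0 < m0 + s * m1 - s `^ q^-1 * ma - s `^ p^-1 * mb.
Proof.
move=> s0 m0E m1E maE mbE.
have /andP[P0 P1] := invp_bounds; have /andP[Q0 Q1] := invq_bounds.
pose z t := s^-1 * t `^ (alpha - 1).
pose w t := s * ((1 - z t `^ p^-1) * (1 - z t `^ q^-1)).
have z0 t : 0 < t -> 0 < z t by move=> t0; rewrite mulr_gt0 ?invr_gt0 ?powR_gt0.
have w0 t : 0 < t -> 0 <= w t.
  move=> t0; exact: mulr_ge0 (ltW s0) (powR_weight_ge0 _ _ _ (mulr_gt0 P0 Q0) (z0 _ t0)).
have mz : measurable_fun [set: R] z.
  by apply: measurable_funM => //; exact: measurable_powR.
have mw : measurable_fun [set: R] w.
  apply: measurable_funM => //.
  by apply: measurable_funM; apply: measurable_funB => //;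
    apply: (@measurable_powRl R _ _ _ z); exact: mz.
(* The only zero of [w] on the half-line is t = s^(1/(alpha-1)), where z = 1. *)
have wpos : {ae mu, forall t, 0 < t -> 0 < w t}.
  exists [set s `^ (alpha - 1)^-1]; split;
    [exact: measurable_set1|exact: lebesgue_measure_set1|].
  move=> t /= /not_implyP [t0 wt]; apply: contrapT => /eqP ts; apply: wt.
  apply: (mulr_gt0 s0 (powR_weight_gt0 _ _ _ (mulr_gt0 P0 Q0) (z0 _ t0) _)).
  apply: contra ts => /eqP zt.
  have <- : t `^ (alpha - 1) = s.
    by move: zt => /(congr1 ( *%R s)); rewrite /z mulrA (mulfV (lt0r_neq0 s0)) mul1r mulr1.
  by rewrite -powRrM mulfV// powRr1// ltW.
have W0 : (0 < \int[mu]_(t in `]0%R, +oo[) ((w t)%:E * k (-1)%R t))%E.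
  rewrite lt0e; apply/andP; split; last first.
    apply: integral_ge0 => t /=; rewrite in_itv/= andbT => t0.
    by rewrite mule_ge0// lee_fin w0.
  by apply/eqP => W0; apply: irr; exact: (reducible_of_integral_eq0 hk w).
have expand (X Y u v : R) : X != 0 -> Y != 0 ->
    X * Y * ((1 - X^-1 * v) * (1 - Y^-1 * u)) + (Y * v + X * u) =
    1 * (u * v) + X * Y * 1.
  by move=> X0 Y0; field; rewrite X0 Y0.
(* The negative terms are moved to the left, so that only nonnegative functions are integrated and
   no subtraction occurs in [\bar R]. *)
have wE t : 0 < t -> w t + (s `^ q^-1 * t `^ b + s `^ p^-1 * t `^ a) =
    1 * t `^ (alpha - 1) + s * t `^ 0.
  move=> t0; rewrite /w /z !powRM ?invr_ge0 ?powR_ge0 ?(ltW s0)//.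
  rewrite -!powRrM powRr0 -(powR_inv1 (ltW s0)) -!powRrM !mulN1r !powRN.
  have sP : s `^ p^-1 != 0 by rewrite gt_eqF ?powR_gt0.
  have sQ : s `^ q^-1 != 0 by rewrite gt_eqF ?powR_gt0.
  have sE : s = s `^ p^-1 * s `^ q^-1.
    by rewrite -powRD ?lt0r_neq0 ?implybT// conj_exp_invD powRr1// ltW.
  have tE : t `^ (alpha - 1) = t `^ a * t `^ b.
    by rewrite -powRD ?lt0r_neq0 ?implybT// abE.
  rewrite [X in X * ((1 - _) * _)]sE [X in _ + X * 1]sE tE.
  exact: expand.
have mc (c r : R) : measurable_fun [set: R] (fun t => c * t `^ r).
  by apply: measurable_funM => //; exact: measurable_powR.
have c0 (c r t : R) : 0 <= c -> 0 <= c * t `^ r by move=> ?; rewrite mulr_ge0 ?powR_ge0.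
have Ia : (\int[mu]_(t in `]0%R, +oo[) ((s `^ q^-1 * t `^ b)%:E * k (-1)%R t) =
    (s `^ q^-1 * ma)%:E)%E.
  by rewrite integral_crossZ; [rewrite subbE maE|exact: powR_ge0].
have Ib : (\int[mu]_(t in `]0%R, +oo[) ((s `^ p^-1 * t `^ a)%:E * k (-1)%R t) =
    (s `^ p^-1 * mb)%:E)%E.
  by rewrite integral_crossZ; [rewrite subaE mbE|exact: powR_ge0].
have I0 : (\int[mu]_(t in `]0%R, +oo[) ((1 * t `^ (alpha - 1))%:E * k (-1)%R t) =
    m0%:E)%E.
  by rewrite integral_crossZ; [rewrite subrr mul1e m0E|exact: ler01].
have I1 : (\int[mu]_(t in `]0%R, +oo[) ((s * t `^ 0)%:E * k (-1)%R t) =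
    (s * m1)%:E)%E.
  by rewrite integral_crossZ; [rewrite subr0 m1E|exact: ltW].
have E : (\int[mu]_(t in `]0%R, +oo[) ((w t)%:E * k (-1)%R t) +
    ((s `^ q^-1 * ma)%:E + (s `^ p^-1 * mb)%:E) = m0%:E + (s * m1)%:E)%E.
  have cge0 (c r : R) : 0 <= c -> forall t, 0 < t -> 0 <= c * t `^ r.
    by move=> cp t _; exact: c0.
  have mab := measurable_funD (mc (s `^ q^-1) b) (mc (s `^ p^-1) a).
  have ab_ge0 t : 0 < t -> 0 <= s `^ q^-1 * t `^ b + s `^ p^-1 * t `^ a.
    by move=> _; rewrite addr_ge0// c0 ?powR_ge0.
  have E1 := integral_crossD _ _ (mc _ _) (mc _ _)
    (cge0 (s `^ q^-1) b (powR_ge0 _ _)) (cge0 (s `^ p^-1) a (powR_ge0 _ _)).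
  have E2 := integral_crossD _ _ (mc _ _) (mc _ _)
    (cge0 1 (alpha - 1) ler01) (cge0 s 0 (ltW s0)).
  rewrite Ia Ib in E1; rewrite I0 I1 in E2.
  rewrite -E1 -E2 -(integral_crossD _ _ mw mab w0 ab_ge0).
  by apply: eq_integral => t; rewrite inE/= in_itv/= andbT => t0; rewrite wE.
(* The value +oo contradicts [E], whose right side is finite, and -oo contradicts [W0]. *)
move: W0 E; case: (integral _ _ _) => [r||]//=.
rewrite -!EFinD lte_fin => r0 []; lra.
Qed.


Lemma D_plus_fin s m0 ma mb gp :
  cross_moment k 0 = m0%:E -> cross_moment k a = ma%:E ->
  cross_moment k b = mb%:E -> gamma_plus alpha k a = gp%:E ->
  D_plus alpha k p s (alpha - 1) =
  (gp + m0 - (p^-1 * s `^ q^-1 * ma + q^-1 * s `^ p^-1 * mb))%:E.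
Proof.
move=> m0E maE mbE gpE.
rewrite /D_plus !C_plusE gamma_plus_sym m0E maE mbE gpE.
rewrite -!EFinM -!EFinD; congr EFin.
transitivity ((p^-1 + q^-1) * (gp + m0)
  - (p^-1 * s `^ q^-1 * ma + q^-1 * s `^ p^-1 * mb)); first by ring.
by rewrite conj_exp_invD mul1r.
Qed.

Lemma D_minus_fin s m1 ma mb gm :
  cross_moment k (alpha - 1) = m1%:E -> cross_moment k a = ma%:E ->
  cross_moment k b = mb%:E -> gamma_minus alpha k a = gm%:E ->
  D_minus alpha k p s (alpha - 1) =
  (gm + m1 - (p^-1 * s `^ (- q^-1) * mb + q^-1 * s `^ (- p^-1) * ma))%:E.
Proof.
move=> m1E maE mbE gmE.
rewrite /D_minus !C_minusE gamma_minus_sym subaE subbE m1E maE mbE gmE.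
rewrite -!EFinM -!EFinD; congr EFin.
rewrite -!powRN; transitivity ((p^-1 + q^-1) * (gm + m1)
  - (p^-1 * s `^ (- q^-1) * mb + q^-1 * s `^ (- p^-1) * ma)); first by ring.
by rewrite conj_exp_invD mul1r.
Qed.

Lemma hardy_W_irreducible :
  (exists S : set R,
    [/\ S !=set0, open S, is_interval S, S `<=` [set s | 0 < s] &
        forall s x : R, S s -> x != 0 -> (0 < hardy_W alpha k p s x)%E])
  /\ (exists s0 D : R, 0 < s0 /\ 0 < D /\
       forall x : R, x != 0 ->
         hardy_W alpha k p s0 x = (D * `|x| `^ (- alpha))%:E).
Proof.
have fin_ex (x : \bar R) : x \is a fin_num -> exists r, x = r%:E.
  by move=> xf; exists (fine x); rewrite fineK.
have [_ a1 a2] := exponent_bounds _ invq_bounds.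
have [_ b1 b2] := exponent_bounds _ invp_bounds.
have [m0 m0E] : exists r, cross_moment k 0 = r%:E.
  by apply: fin_ex; rewrite (cross_moment_fin hk).
have [m1 m1E] : exists r, cross_moment k (alpha - 1) = r%:E.
  by apply: fin_ex; have [? ?] := (al0, al2); rewrite (cross_moment_fin hk)//; lra.
have [ma maE] : exists r, cross_moment k a = r%:E.
  by apply: fin_ex; rewrite (cross_moment_fin hk).
have [mb mbE] : exists r, cross_moment k b = r%:E.
  by apply: fin_ex; rewrite (cross_moment_fin hk).
have [gp gpE] : exists r, gamma_plus alpha k a = r%:E.
  exact: fin_ex gamma_plus_fin.
have [gm gmE] : exists r, gamma_minus alpha k a = r%:E.
  exact: fin_ex gamma_minus_fin.
have ma0 : 0 < ma by rewrite -lte_fin -maE cross_moment_gt0.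
have mb0 : 0 < mb by rewrite -lte_fin -mbE cross_moment_gt0.
have gp0 : 0 <= gp by rewrite -lee_fin -gpE gamma_plus_ge0.
have gm0 : 0 <= gm by rewrite -lee_fin -gmE gamma_minus_ge0.
have DpE s := D_plus_fin s _ _ _ _ m0E maE mbE gpE.
have DmE s := D_minus_fin s _ _ _ _ m1E maE mbE gmE.
have mom s (s0 : 0 < s) := moments_gt0 s _ _ _ _ s0 m0E m1E maE mbE.
have /andP[P0 _] := invp_bounds; have /andP[Q0 _] := invq_bounds.
have [s0 [s00 dE d0]] := balanced_point _ _ _ _ _ _ _ _ P0 Q0 conj_exp_invD ma0 mb0 gp0 gm0 mom.
move=> /nbhs_ballP[e /= e0 He].
split; last first.
  exists s0, (gp + m0 - (p^-1 * s0 `^ q^-1 * ma + q^-1 * s0 `^ p^-1 * mb)).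
  split => //; split => // x x0.
  by rewrite /hardy_W DpE DmE -dE if_same -EFinM mulrC.
exists (ball s0 e); split.
- by exists s0; exact: ballxx.
- exact: ball_open.
- by rewrite ball_itv; exact: interval_is_interval.
- by move=> s /He[].
move=> s x /He[_ dps dms] x0; rewrite /hardy_W DpE DmE.
rewrite mule_gt0// ?lte_fin ?powR_gt0 ?normr_gt0//.
by case: ifPn; rewrite lte_fin.
Qed.

End HardyConstants.

(** * Pointwise inequalities for the p-form and for differences of logarithms *)

Section Pointwise.
Context {R : realType}.
Implicit Types a b s t x y : R.

Lemma spow_nneg x s : 0 <= x -> s != 0 -> spow x s = x `^ s.
Proof.
(* At x = 0 a nonzero exponent matters, since powR gives 0^0 = 1 whereas [spow] gives 0. *)
rewrite le_eqVlt => /predU1P[<-|x0] s0; first by rewrite /spow sgr0 mulr0 powR0.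
by rewrite /spow gtr0_sg// mulr1 gtr0_norm.
Qed.

Lemma spowN x s : spow (- x) s = - spow x s.
Proof. by rewrite /spow normrN sgrN mulrN. Qed.

Lemma spow_ge0 x s : 0 <= x -> 0 <= spow x s.
Proof. by move=> x0; rewrite mulr_ge0 ?powR_ge0 ?sgr_ge0. Qed.

Lemma spow_nondecreasing s x y : 0 < s -> x <= y -> spow x s <= spow y s.
Proof.
move=> s0; wlog y0 : x y / 0 <= y => [H|] xy.
  have [y0|y0] := leP 0 y; first exact: H.
  rewrite -[x]opprK -[y]opprK !(spowN (- _)) lerN2.
  by apply: H; [rewrite oppr_ge0 ltW// (le_lt_trans xy)|rewrite lerN2].
have [x0|x0] := leP 0 x.
  rewrite !spow_nneg ?gt_eqF//.
  by apply: ge0_ler_powR; rewrite ?nnegrE// ltW.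
apply: (@le_trans _ _ 0); last exact: spow_ge0.
by rewrite -[x]opprK spowN oppr_le0 spow_ge0// oppr_ge0 ltW.
Qed.

Lemma spow_form_ge0 s x y : 0 < s -> 0 <= (x - y) * (spow x s - spow y s).
Proof.
move=> s0; have [xy|xy] := leP x y.
  by rewrite mulr_le0// subr_le0// spow_nondecreasing.
by rewrite mulr_ge0// subr_ge0 ?spow_nondecreasing// ltW.
Qed.

(* By AM-GM, x y^(p-1) + y x^(p-1) >= 2 (x y)^(p/2). *)
Lemma spow_form_le p x y : 1 < p -> 0 <= x -> 0 <= y ->
  (x - y) * (spow x (p - 1) - spow y (p - 1)) <= (x `^ (p / 2) - y `^ (p / 2)) ^+ 2.
Proof.
move=> p1 x0 y0.
have p0 : 0 < p by lra.
have q0 : p - 1 != 0 by rewrite gt_eqF; lra.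
rewrite !spow_nneg//.
have sq z : 0 <= z -> (z `^ (p / 2)) ^+ 2 = z `^ p.
  by move=> z0; rewrite -powR_mulrn ?powR_ge0// -powRrM mulfVK.
set X := x * y `^ (p - 1); set Y := y * x `^ (p - 1).
have X0 : 0 <= X by rewrite mulr_ge0 ?powR_ge0.
have Y0 : 0 <= Y by rewrite mulr_ge0 ?powR_ge0.
set G := x `^ (p / 2) * y `^ (p / 2).
have G0 : 0 <= G by rewrite mulr_ge0 ?powR_ge0.
have GE : G ^+ 2 = X * Y.
  rewrite /G exprMn !sq// -(mulr_powRB1 x0 p0) -(mulr_powRB1 y0 p0) /X /Y; ring.
have GXY : 2 * G <= X + Y.
  rewrite -(@ler_sqr _ (2 * G) (X + Y)) ?nnegrE; [|exact: mulr_ge0|exact: addr_ge0].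
  rewrite exprMn GE.
  by rewrite -subr_ge0 (_ : _ - _ = (X - Y) ^+ 2) ?sqr_ge0//; ring.
have -> : (x - y) * (x `^ (p - 1) - y `^ (p - 1)) = x `^ p + y `^ p - (X + Y).
  by rewrite -(mulr_powRB1 x0 p0) -(mulr_powRB1 y0 p0) /X /Y; ring.
have -> : (x `^ (p / 2) - y `^ (p / 2)) ^+ 2 = x `^ p + y `^ p - 2 * G.
  by rewrite sqrrB !sq// /G; ring.
by rewrite lerD2l lerN2.
Qed.

(** A symmetric majorant, homogeneous of degree -2, for (ln a - ln b)^2 / (a - b)^2 up to a
    constant. For a = 1 it is b^(-1/2) on ]0, 1] and b^(-3/2) beyond: powers that absorb the squared
    logarithm and stay integrable at both ends. *)
Definition log_majorant a b : R :=
  Num.min (a `^ (- (3 / 2)) * b `^ (- (1 / 2))) (a `^ (- (1 / 2)) * b `^ (- (3 / 2))).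

Lemma log_majorantC a b : log_majorant a b = log_majorant b a.
Proof. by rewrite /log_majorant minC mulrC (mulrC (a `^ (- (3 / 2)))). Qed.

Lemma log_majorant_ge0 a b : 0 <= log_majorant a b.
Proof. by rewrite le_min !mulr_ge0 ?powR_ge0. Qed.

Lemma log_majorantZ r a b : 0 < r -> 0 < a -> 0 <= b ->
  log_majorant (r * a) (r * b) = r `^ (- 2) * log_majorant a b.
Proof.
move=> r0 a0 b0; rewrite /log_majorant minr_pMr ?powR_ge0// !powRM ?(ltW r0) ?(ltW a0)//.
have E u v : - u + - v = - 2 -> r `^ (- 2) = r `^ (- u) * r `^ (- v) :> R.
  by move=> <-; rewrite powRD// lt0r_neq0 ?implybT.
by congr Num.min; rewrite mulrACA; congr (_ * _); apply/esym/E; lra.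
Qed.

(** With a = b r^4 and r >= 1 all half-integer powers of a/b become integer powers of r. Then ln a -
    ln b = 4 ln r <= 4 (r - 1), the majorant is r^-6 b^-2, and what remains is r^3 (r - 1) <= r^4 -
    1. The 16 is the square of this 4. *)
Lemma sqr_lnB_le a b : 0 < a -> 0 < b ->
  (ln a - ln b) ^+ 2 <= 16 * log_majorant a b * (a - b) ^+ 2.
Proof.
wlog ba : a b / b <= a => [H a0 b0|a0 b0].
  have [ba|ab] := leP b a; first exact: H.
  rewrite log_majorantC -sqrrN opprB -(sqrrN (a - b)) opprB.
  by apply: H => //; exact: ltW.
pose r := (a / b) `^ (1 / 4).
have ab0 : 0 < a / b by rewrite divr_gt0.
have r0 : 0 < r by rewrite powR_gt0.
have r1 : 1 <= r.
  have e1 : 1 `^ (1 / 4) = 1 :> R by rewrite powR1.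
  rewrite -[leLHS]e1; apply: ge0_ler_powR; rewrite ?nnegrE ?(ltW ab0)//.
  by rewrite ler_pdivlMr// mul1r.
have rn n : r ^+ n = (a / b) `^ (n%:R / 4).
  by rewrite -powR_mulrn ?(ltW r0)// /r -powRrM; congr powR; lra.
have aE : a = b * r ^+ 4.
  by rewrite rn mulfV// powRr1 ?(ltW ab0)// mulrCA mulfV ?gt_eqF// mulr1.
have lnr : ln a - ln b = 4 * ln r.
  by rewrite -ln_div ?posrE// /r ln_powR; lra.
have lnr_le : 0 <= ln r <= r - 1.
  by rewrite ln_ge0//= -{1}(subrK 1 r) addrC le_ln1Dx//; lra.
have maj (u v : R) (n : nat) : 4 * u = n%:R -> u + v = 2 ->
    a `^ (- u) * b `^ (- v) = r ^- n * b ^- 2.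
  move=> un uv; rewrite aE powRM ?exprn_ge0 ?(ltW b0) ?(ltW r0)//.
  rewrite -!powR_invn ?(ltW b0) ?(ltW r0)// -(powR_mulrn 4 (ltW r0)) -powRrM.
  rewrite mulrAC -powRD ?lt0r_neq0 ?implybT// mulrC.
  by congr (_ `^ _ * _ `^ _); rewrite -?un -?uv; lra.
have majE : log_majorant a b = r ^- 6 * b ^- 2.
  have r32 : a `^ (- (3 / 2)) * b `^ (- (1 / 2)) = r ^- 6 * b ^- 2.
    by apply: maj; lra.
  have r12 : a `^ (- (1 / 2)) * b `^ (- (3 / 2)) = r ^- 2 * b ^- 2.
    by apply: maj; lra.
  rewrite /log_majorant r32 r12; apply/min_idPl.
  rewrite ler_pM2r ?invr_gt0 ?exprn_gt0// lef_pV2 ?posrE ?exprn_gt0//.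
  exact: ler_weXn2l.
rewrite lnr majE aE.
have -> : 16 * (r ^- 6 * b ^- 2) * (b * r ^+ 4 - b) ^+ 2 = (4 * (r ^- 3 * (r ^+ 4 - 1))) ^+ 2.
  by field; rewrite !gt_eqF.
rewrite ler_sqr ?nnegrE.
- rewrite ler_pM2l//; case/andP: lnr_le => _ h; apply: (le_trans h).
  rewrite mulrC ler_pdivlMr ?exprn_gt0//.
  have : 1 <= r ^+ 3 by exact: exprn_ege1.
  nra.
- by case/andP: lnr_le => h _; rewrite mulr_ge0.
- rewrite !mulr_ge0 ?invr_ge0 ?exprn_ge0 ?(ltW r0)// subr_ge0.
  exact: exprn_ege1.
Qed.

End Pointwise.

(** * The logarithmic cutoff and the test functions built from it *)

Section LogCutoff.
Context {R : realType}.
Local Notation mu := (@lebesgue_measure R).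
Variables (N : R) (N0 : 0 < N).

(* [Num.max] keeps the argument of [ln] away from 0, where [ln] is 0. *)
Definition log_cutoff (x : R) : R :=
  Num.min 1 (Num.max 0 (2 - `|ln (Num.max `|x| (expR (- (2 * N))))| / N)).

Lemma log_cutoff_ge0 x : 0 <= log_cutoff x.
Proof. by rewrite le_min ler01 le_max lexx. Qed.

Let d0 : 0 < expR (- (2 * N)). Proof. exact: expR_gt0. Qed.

Lemma log_cutoff_out x : log_cutoff x != 0 -> expR (- (2 * N)) <= `|x| <= expR (2 * N).
Proof.
apply: contraR; rewrite negb_and -!ltNge => hx; apply/eqP.
suff h : 2 * N <= `|ln (Num.max `|x| (expR (- (2 * N))))|.
  rewrite /log_cutoff max_l; first by apply/min_idPr; exact: ler01.
  by rewrite subr_le0 ler_pdivlMr.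
case/orP: hx => hx.
  by rewrite max_r ?(ltW hx)// expRK normrN gtr0_norm// mulr_gt0.
have x0 : 0 < `|x| by rewrite (lt_trans _ hx)// expR_gt0.
apply: le_trans (ler_norm _).
rewrite -[leLHS]expRK ler_ln ?posrE ?expR_gt0//; last by rewrite lt_max x0.
by rewrite le_max ltW.
Qed.

Lemma log_cutoff_in x : expR (- N) <= `|x| <= expR N -> log_cutoff x = 1.
Proof.
move=> /andP[x1 x2]; apply/min_idPl; rewrite le_max; apply/orP; right.
have x0 : 0 < `|x| by rewrite (lt_le_trans _ x1)// expR_gt0.
rewrite max_l; last by rewrite (le_trans _ x1)// ler_expR; have := N0; lra.
suff : `|ln `|x| | / N <= 1 by lra.
rewrite ler_pdivrMr// mul1r ler_norml.
by rewrite -{1}(expRK (- N)) -{2}(expRK N) !ler_ln ?posrE ?expR_gt0// x1 x2.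
Qed.

(** Both truncations and the absolute value are 1-Lipschitz in ln|x|, so the division by N is the
    only contribution to the slope. *)
Lemma log_cutoff_lip x y : x != 0 -> y != 0 ->
  (log_cutoff x - log_cutoff y) ^+ 2 <= N ^- 2 * (ln `|x| - ln `|y|) ^+ 2.
Proof.
move=> x0 y0.
have lnmax (z : R) : z != 0 ->
    ln (Num.max `|z| (expR (- (2 * N)))) = Num.max (ln `|z|) (- (2 * N)).
  move=> z0; have z0' : 0 < `|z| by rewrite normr_gt0.
  rewrite -{2}(expRK (- (2 * N))).
  have [h|h] := leP `|z| (expR (- (2 * N))).
    by rewrite !max_r// ler_ln ?posrE.
  by rewrite !max_l ?(ltW h)// ler_ln ?posrE// ltW.
rewrite /log_cutoff !lnmax//; set u := ln `|x|; set v := ln `|y|.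
rewrite -[leLHS]real_normK ?num_real// -[X in _ <= _ * X]real_normK ?num_real//.
rewrite -exprVn -exprMn ler_sqr ?nnegrE// ?mulr_ge0// ?invr_ge0 ?(ltW N0)//.
have clamp (s t : R) : `|Num.min 1 (Num.max 0 s) - Num.min 1 (Num.max 0 t)| <= `|s - t|.
  have h1 := ler_norm (s - t); have h2 := ler_norm (t - s).
  (* Abstracting the norm to a variable above both differences leaves linear goals in each case. *)
  rewrite distrC in h2; move: h1 h2; move: `|s - t| => D h1 h2.
  have D0 : 0 <= D by lra.
  have [s0|s0] := leP 0 s; have [t0|t0] := leP 0 t;
    [case: (leP 1 s); case: (leP 1 t)|case: (leP 1 s); case: (leP 1 0)|
     case: (leP 1 0); case: (leP 1 t)|case: (leP 1 0)] => *;
    rewrite ler_norml; apply/andP; split; lra.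
apply: (le_trans (clamp _ _)).
set c := - (2 * N); set U := `|Num.max u c|; set V := `|Num.max v c|.
have -> : 2 - U / N - (2 - V / N) = N^-1 * (V - U) by ring.
have Ni : 0 < N^-1 by rewrite invr_gt0.
rewrite normrM (gtr0_norm Ni) ler_pM2l//.
apply: (le_trans (ler_dist_dist _ _)); rewrite (distrC u).
have h1 := ler_norm (v - u); have h2 := ler_norm (u - v).
rewrite distrC in h2; move: h1 h2; move: `|v - u| => D h1 h2.
have D0 : 0 <= D by lra.
by case: (leP u c); case: (leP v c) => *; rewrite ler_norml; apply/andP; split; lra.
Qed.

Lemma continuous_log_cutoff : continuous log_cutoff.
Proof.
move=> x.
pose h (y : R) := Num.max `|y| (expR (- (2 * N))).
have ch : {for x, continuous h}.
  by apply: (@continuous_max R R); [exact: norm_continuous|exact: cvg_cst].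
have cl : {for x, continuous (fun y => 2 - `|ln (h y)| / N)}.
  apply: cvgB; first exact: cvg_cst.
  apply: cvgMl; apply: cvg_norm; apply: (@continuous_comp _ _ _ h (@ln R) x ch).
  by apply: continuous_ln; rewrite lt_max d0 orbT.
apply: (@continuous_min R R (cst 1) (fun y => Num.max 0 (2 - `|ln (h y)| / N)) x).
  exact: cvg_cst.
by apply: (@continuous_max R R (cst 0)) => //; exact: cvg_cst.
Qed.

Lemma continuous_powR_nneg (f : R -> R) (s : R) : 0 < s ->
  (forall x, 0 <= f x) -> continuous f -> continuous (fun x => f x `^ s).
Proof.
move=> s0 f0 cf x; have := f0 x; rewrite le_eqVlt => /predU1P[fx0|fx0]; last first.
  exact: (@continuous_comp _ _ _ f (fun t => t `^ s) x (cf x) (continuous_powR_gt0 _ _ fx0)).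
(* At a zero of [f] the power need not be differentiable; the threshold e^(1/s) on [f] gives the
   bound e directly. *)
rewrite /continuous_at -fx0 powR0 ?gt_eqF//; apply/cvgrPdist_le => e e0.
have es : 0 < e `^ s^-1 by exact: powR_gt0.
near=> y; rewrite sub0r normrN ger0_norm ?powR_ge0//.
have -> : e = (e `^ s^-1) `^ s by rewrite -powRrM mulVf ?gt_eqF// powRr1// ltW.
apply: ge0_ler_powR; rewrite ?nnegrE ?f0 ?(ltW es) ?(ltW s0)//.
near: y; have := cvgr_le _ (cf x); apply; by rewrite -fx0.
Unshelve. all: by end_near. Qed.

Variables (p : R) (p0 : 0 < p).

Definition cutoff_fun (x : R) : R := log_cutoff x `^ (2 / p).

Lemma cutoff_fun_ge0 x : 0 <= cutoff_fun x. Proof. exact: powR_ge0. Qed.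

Lemma cutoff_funK x : cutoff_fun x `^ (p / 2) = log_cutoff x.
Proof.
rewrite -powRrM (_ : 2 / p * (p / 2) = 1) ?powRr1 ?log_cutoff_ge0//.
by field; rewrite gt_eqF.
Qed.

Lemma continuous_cutoff_fun : continuous cutoff_fun.
Proof.
apply: continuous_powR_nneg; [by rewrite divr_gt0|exact: log_cutoff_ge0|].
exact: continuous_log_cutoff.
Qed.

Lemma Cc_cutoff_fun : Cc_Rstar cutoff_fun.
Proof.
have sub : closure [set x | cutoff_fun x != 0] `<=`
    [set x : R | expR (- (2 * N)) <= `|x| <= expR (2 * N)].
  have cl : closed [set x : R | expR (- (2 * N)) <= `|x| <= expR (2 * N)].
    rewrite (_ : [set x | _] = (fun x : R => `|x|) @^-1` `[expR (- (2 * N)), expR (2 * N)]).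
      by apply: preimage_closed; [move=> x _; exact: norm_continuous|exact: interval_closed].
    by apply/seteqP; split => x /=; rewrite in_itv.
  move/closure_id : cl => ->; apply: closureS => x /= ux; apply: log_cutoff_out.
  by apply: contra ux => /eqP lx; rewrite /cutoff_fun lx powR0// gt_eqF// divr_gt0.
split; first exact: continuous_cutoff_fun.
split.
  apply: (subclosed_compact (@closed_closure _ _)
    (@segment_compact R (- expR (2 * N)) (expR (2 * N)))).
  by move=> x /sub /= /andP[_]; rewrite in_itv/= ler_norml.
move=> x /sub /= /andP[h _]; rewrite /Rstar/= -normr_gt0; exact: lt_le_trans h.
Qed.

End LogCutoff.

(** * The energy of the test functions is of order 1/N *)

Section CutoffEnergy.
Context {R : realType}.
Implicit Types x y N c : R.
Local Notation mu := (@lebesgue_measure R).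

Lemma measurable_log_majorant d (T : measurableType d) (f g : T -> R) :
  measurable_fun [set: T] f -> measurable_fun [set: T] g ->
  measurable_fun [set: T] (fun z => (log_majorant (f z) (g z))%:E).
Proof.
move=> mf mg; apply/measurable_EFinP.
by apply: measurable_minr; apply: measurable_funM; exact: measurable_powRl.
Qed.

Let total := (\int[mu]_t (log_majorant 1 `|t|)%:E)%E.

Lemma integral_log_majorant_lty : (total < +oo)%E.
Proof.
have m1 : measurable_fun [set: R] (fun t => (log_majorant 1 `|t|)%:E).
  exact: measurable_log_majorant.
rewrite /total ge0_integral_halves//; last by move=> t; rewrite lee_fin log_majorant_ge0.
have half : (\int[mu]_(t in `]0%R, +oo[) (log_majorant 1 `|t|)%:E < +oo)%E.
  apply: (@integral_powR_lty _ _ 1 (- (1 / 2)) (- (3 / 2))) => //; [lra|lra|..].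
  - by move=> t; rewrite lee_fin log_majorant_ge0.
  - move=> t /andP[t0 _]; rewrite lee_fin ge_min gtr0_norm//.
    by rewrite powR1 lexx.
  - move=> t t1; rewrite lee_fin ge_min gtr0_norm; last by lra.
    by rewrite powR1 lexx orbT.
apply: lte_add_pinfty; first exact: half.
by under eq_integral do rewrite normrN.
Qed.

(** Rescaling y by |x| costs |x| from the Jacobian and gains |x|^-2 from homogeneity, which produces
    the scale-invariant density 1/|x|. *)
Lemma integral_log_majorant x : x != 0 ->
  (\int[mu]_y (log_majorant `|x| `|y|)%:E = (`|x| `^ (-1))%:E * total)%E.
Proof.
move=> x0; have nx0 : 0 < `|x| by rewrite normr_gt0.
rewrite (@ge0_integral_affine _ `|x| 0); first last.
- by move=> t; rewrite lee_fin log_majorant_ge0.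
- exact: measurable_log_majorant.
- exact: lt0r_neq0.
rewrite (_ : (\int[_]_y _)%E = 
  (\int[mu]_y ((`|x| `^ (- 2))%:E * (log_majorant 1 `|(y : R)|)%:E))%E).
  rewrite ge0_integralZl//; first last.
  - by move=> t _; rewrite lee_fin log_majorant_ge0.
  - exact: measurable_log_majorant.
  rewrite muleA -EFinM normr_id mulr_powRD1//; congr (_%:E * _)%E; congr powR; lra.
apply: eq_integral => t _; rewrite addr0 normrM normr_id -{1}(mulr1 `|x|).
by rewrite log_majorantZ// EFinM.
Qed.

Let annulus (N x : R) := (expR (- (2 * N)) <= `|x|) && (`|x| <= expR (2 * N)).

Let measurable_annulus N : measurable_fun [set: R] (annulus N).
Proof. by apply: measurable_and; apply: measurable_fun_ler. Qed.

(** On each half-line ln|x| runs from -2N to 2N, a logarithmic length of 4N. *)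
Lemma integral_annulus N : 0 < N ->
  (\int[mu]_x (if annulus N x then (`|x| `^ (-1))%:E else 0) = (8 * N)%:E)%E.
Proof.
move=> N0.
have m1 : measurable_fun [set: R]
    (fun x => if annulus N x then (`|x| `^ (-1))%:E else 0%E).
  apply: measurable_fun_ifT => //.
  by apply/measurable_EFinP; exact: measurable_powRl.
rewrite ge0_integral_halves//; last by move=> t; case: ifPn; rewrite ?lee_fin ?powR_ge0.
have e0 : 0 < expR (- (2 * N)) by exact: expR_gt0.
have half : (\int[mu]_(x in `]0%R, +oo[) (if annulus N x then (`|x| `^ (-1))%:E else 0) =
    (4 * N)%:E)%E.
  transitivity (\int[mu]_(x in `[expR (- (2 * N)), expR (2 * N)]) (x^-1)%:E)%E.
    rewrite (@integral_if _ _ (fun x => 0 < x)); last by move=> x; rewrite set_itvE/=.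
    rewrite [RHS](@integral_if _ _ (fun x => expR (- (2 * N)) <= x <= expR (2 * N))); last first.
      by move=> x; rewrite set_itvE/=.
    apply: eq_integral => x _; rewrite /annulus.
    have [x0|x0] := ltP 0 x; last first.
      by rewrite [X in if X then _ else _](_ : _ = false)// lt_geF// (le_lt_trans x0).
    by rewrite gtr0_norm// powR_inv1// ltW.
  rewrite integral_inv_itv// ?ltr_expR; last by lra.
  by rewrite !expRK; congr EFin; lra.
rewrite half (_ : (\int[mu]_(t in `]0%R, +oo[) _)%E = (4 * N)%:E).
  by rewrite -EFinD; congr EFin; lra.
rewrite -[RHS]half; apply: eq_integral => x _.
by rewrite /annulus normrN.
Qed.

Variables (k : R -> R -> \bar R) (p : R).
Hypotheses (hk : hom_kernel 1 k) (p1 : 1 < p).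

Let k0 x y : (0 <= k x y)%E := hom_kernel_ge0 hk x y.

Lemma measurable_spow s : measurable_fun [set: R] (fun x : R => spow x s).
Proof.
apply: measurable_funM; first exact: measurable_powRl.
rewrite (_ : @Num.sg R = fun x => if x == 0 then 0 else if x < 0 then -1 else 1).
  apply: measurable_fun_ifT => //; first exact: measurable_fun_eqr.
  by apply: measurable_fun_ifT => //; exact: measurable_fun_ltr.
by [].
Qed.

Let form (u : R -> R) x y := (u x - u y) * (spow (u x) (p - 1) - spow (u y) (p - 1)).

Let measurable_form u : measurable_fun [set: R] u ->
  measurable_fun [set: R * R] (fun z => (form u z.1 z.2)%:E * k z.1 z.2)%E.
Proof.
move=> mu'; apply: emeasurable_funM; last exact: hom_kernel_measurable hk.
have m1 : measurable_fun [set: R * R] (fun z => u z.1) by exact: measurableT_comp.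
have m2 : measurable_fun [set: R * R] (fun z => u z.2) by exact: measurableT_comp.
apply/measurable_EFinP; apply: measurable_funM; first exact: measurable_funB.
by apply: measurable_funB; apply: (measurableT_comp (measurable_spow (p - 1))).
Qed.

Lemma form_ge0 u x y : (0 <= (form u x y)%:E * k x y)%E.
Proof. by rewrite mule_ge0// lee_fin spow_form_ge0//; have := p1; lra. Qed.

Lemma energy_ge0 u : (0 <= energy k p u)%E.
Proof.
rewrite mule_ge0 ?lee_fin ?invr_ge0//.
by apply: integral_ge0 => x _; apply: integral_ge0 => y _; exact: form_ge0.
Qed.

(** The form vanishes unless one of the points lies in the annulus, hence the sum of indicators.
    Otherwise the log-Lipschitz bound and [sqr_lnB_le] produce a factor (|x| - |y|)^2 <= |x - y|^2,
    which cancels the kernel bound c |x - y|^-2. *)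
Lemma form_cutoff_le c N x y : 0 < N -> 0 < c ->
  (forall x y, x != y -> (k x y <= (c * `|x - y| `^ (- 1 - 1))%:E)%E) ->
  x != 0 -> y != 0 ->
  ((form (cutoff_fun N p) x y)%:E * k x y <=
   ((16 * c / N ^+ 2) * ((annulus N x)%:R + (annulus N y)%:R) * log_majorant `|x| `|y|)%:E)%E.
Proof.
move=> N0 c0 kc x0 y0.
have p0 : 0 < p by have := p1; lra.
have K0 : 0 < 16 * c / N ^+ 2 by rewrite divr_gt0 ?exprn_gt0// mulr_gt0.
have rhs0 : 0 <= (16 * c / N ^+ 2) * ((annulus N x)%:R + (annulus N y)%:R) * log_majorant `|x| `|y|.
  by rewrite mulr_ge0 ?log_majorant_ge0// mulr_ge0 ?addr_ge0 ?ler0n// ltW.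
have [xy|xy] := eqVneq x y; first by move: rhs0; rewrite xy /form subrr mul0r mul0e lee_fin.
have [/andP[xa ya]|] := boolP (~~ annulus N x && ~~ annulus N y).
  have cut0 z : ~~ annulus N z -> log_cutoff N z = 0.
    by move=> az; apply/eqP; apply: contraNT az; exact: log_cutoff_out.
  by rewrite /form /cutoff_fun !cut0// subrr mul0r mul0e lee_fin.
rewrite -negb_or negbK => ann.
apply: (@le_trans _ _ (((log_cutoff N x - log_cutoff N y) ^+ 2)%:E *
  (c * `|x - y| `^ (- 1 - 1))%:E)%E).
  apply: lee_pmul => //; last exact: kc.
    by rewrite lee_fin spow_form_ge0//; have := p1; lra.
  rewrite lee_fin -(cutoff_funK N p p0 x) -(cutoff_funK N p p0 y).
  by apply: spow_form_le => //; exact: cutoff_fun_ge0.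
rewrite -EFinM lee_fin.
have d0 : 0 < `|x - y| by rewrite normr_gt0 subr_eq0.
have -> : `|x - y| `^ (- 1 - 1) = `|x - y| ^- 2.
  by rewrite -powR_invn ?normr_ge0//; congr powR; lra.
have h1 := log_cutoff_lip _ N0 _ _ x0 y0.
have h2 : (ln `|x| - ln `|y|) ^+ 2 <= 16 * log_majorant `|x| `|y| * (`|x| - `|y|) ^+ 2.
  by apply: sqr_lnB_le; rewrite normr_gt0.
have h3 : (`|x| - `|y|) ^+ 2 <= `|x - y| ^+ 2.
  rewrite -[leLHS]real_normK ?num_real// ler_sqr ?nnegrE//; exact: ler_dist_dist.
have M0 := log_majorant_ge0 `|x| `|y|.
have h4 : (log_cutoff N x - log_cutoff N y) ^+ 2 <=
    N ^- 2 * (16 * log_majorant `|x| `|y| * `|x - y| ^+ 2).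
  apply: (le_trans h1); rewrite ler_pM2l ?invr_gt0 ?exprn_gt0//.
  by apply: (le_trans h2); rewrite ler_wpM2l// mulr_ge0.
have -> : (log_cutoff N x - log_cutoff N y) ^+ 2 * (c * `|x - y| ^- 2) =
  ((log_cutoff N x - log_cutoff N y) ^+ 2 * `|x - y| ^- 2) * c by ring.
have h5 : (log_cutoff N x - log_cutoff N y) ^+ 2 * `|x - y| ^- 2 <= 
    N ^- 2 * (16 * log_majorant `|x| `|y|).
  by rewrite ler_pdivrMr ?exprn_gt0// -mulrA.
apply: (@le_trans _ _ ((16 * c / N ^+ 2) * log_majorant `|x| `|y|)).
  rewrite (_ : 16 * c / N ^+ 2 * _ = N ^- 2 * (16 * log_majorant `|x| `|y|) * c); last by ring.
  by rewrite ler_pM2r.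
rewrite ler_wpM2r// ler_peMr ?(ltW K0)//.
by case/orP: ann => ->; rewrite ?lerDl ?lerDr ler0n.
Qed.

Lemma energy_cutoff_le : exists C : R, 0 <= C /\ forall N : R, 0 < N ->
  (energy k p (cutoff_fun N p) <= (C / N)%:E)%E.
Proof.
have [c [c0 kc]] := hom_kernel_bound hk.
have p0 : 0 < p by have := p1; lra.
have tot0 : (0 <= total)%E by apply: integral_ge0 => t _; rewrite lee_fin log_majorant_ge0.
have [A [A0 totE]] : exists A : R, 0 <= A /\ total = A%:E.
  have tf : total \is a fin_num by rewrite ge0_fin_numE// integral_log_majorant_lty.
  by exists (fine total); rewrite fineK// fine_ge0.
(* The constant is 1/2 times 16 c / N^2 times two copies, one per indicator, of 8 N A. *)
exists (128 * c * A); split; first by rewrite !mulr_ge0// ltW.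
move=> N N0.
pose F x y : \bar R := if annulus N x then (log_majorant `|x| `|y|)%:E else 0%E.
have F0 x y : (0 <= F x y)%E by rewrite /F; case: ifPn; rewrite ?lee_fin ?log_majorant_ge0.
have mF : measurable_fun [set: R * R] (fun z => F z.1 z.2).
  have m1 : measurable_fun [set: R * R] (fun z => annulus N z.1).
    exact: (measurableT_comp (measurable_annulus N)).
  apply: measurable_fun_ifT => //.
  by apply: measurable_log_majorant; exact: measurableT_comp.
have mFC : measurable_fun [set: R * R] (fun z => F z.2 z.1).
  have m1 : measurable_fun [set: R * R] (fun z => annulus N z.2).
    exact: (measurableT_comp (measurable_annulus N)).
  apply: measurable_fun_ifT => //.
  by apply: measurable_log_majorant; exact: measurableT_comp.
have intF : (\int[mu]_x \int[mu]_y F x y = (8 * N * A)%:E)%E.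
  have m1 : measurable_fun [set: R]
      (fun x => if annulus N x then (`|x| `^ (-1))%:E else 0%E).
    apply: measurable_fun_ifT => //.
    by apply/measurable_EFinP; exact: measurable_powRl.
  rewrite mulrC EFinM -integral_annulus// -ge0_integralZl//; last first.
    by move=> x _; case: ifPn; rewrite ?lee_fin ?powR_ge0.
  apply: eq_integral => x _; rewrite /F; case: ifPn => [/andP[xa _]|_]; last first.
    by rewrite mule0 integral0.
  rewrite integral_log_majorant ?totE 1?muleC//.
  by rewrite -normr_gt0 (lt_le_trans _ xa)// expR_gt0.
have intFC : (\int[mu]_x \int[mu]_y F y x = (8 * N * A)%:E)%E.
  by rewrite -intF [RHS]ge0_integral_swap.
pose K := 16 * c / N ^+ 2.
have K0 : 0 < K by rewrite divr_gt0 ?exprn_gt0// mulr_gt0.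
pose u := cutoff_fun N p.
have mform : measurable_fun [set: R * R] (fun z => (form u z.1 z.2)%:E * k z.1 z.2)%E.
  by apply: measurable_form; apply: continuous_measurable_fun; exact: continuous_cutoff_fun.
pose G x y := (K%:E * (F x y + F y x))%E.
have G0 x y : (0 <= G x y)%E by rewrite mule_ge0 ?adde_ge0 ?lee_fin ?(ltW K0).
have mG : measurable_fun [set: R * R] (fun z => G z.1 z.2).
  by apply: measurable_funeM; exact: emeasurable_funD.
have slice (H : R -> R -> \bar R) x : measurable_fun [set: R * R] (fun z => H z.1 z.2) ->
    measurable_fun [set: R] (H x).
  by move=> mH; exact: (measurableT_comp mH (measurable_pair1 x)).
have outer (H : R -> R -> \bar R) : measurable_fun [set: R * R] (fun z => H z.1 z.2) ->
    (forall x y, (0 <= H x y)%E) -> measurable_fun [set: R] (fun x => \int[mu]_y H x y)%E.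
  move=> mH H0.
  by have := @measurable_fun_fubini_tonelli_F _ _ _ _ R mu (fun z => H z.1 z.2) mH; apply.
have le_G x y : x != 0 -> y != 0 -> ((form u x y)%:E * k x y <= G x y)%E.
  move=> x0 y0; apply: (le_trans (form_cutoff_le c N x y N0 c0 kc x0 y0)).
  rewrite /G /F (log_majorantC `|y|) -mulrA EFinM lee_pmul2l//.
  by case: (annulus N x); case: (annulus N y); rewrite /= ?adde0 ?add0e -?EFinD lee_fin; lra.
have le_int : (\int[mu]_x \int[mu]_y ((form u x y)%:E * k x y) <=
    \int[mu]_x \int[mu]_y G x y)%E.
  apply: ae_ge0_le_integral => //.
  - by move=> x _; apply: integral_ge0 => y _; exact: form_ge0.
  - by apply: (outer (fun x y => (form u x y)%:E * k x y)%E) => // x y; exact: form_ge0.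
  - by move=> x _; apply: integral_ge0.
  - exact: outer.
  (* The pointwise bound goes through ln|x| and ln|y| and is available only off the axes, hence
     comparison almost everywhere in both variables. *)
  apply: (ae_impl _ (ae_neq 0)) => x x0 _; apply: ae_ge0_le_integral => //.
  - by move=> y _; exact: form_ge0.
  - exact: (slice (fun x y => (form u x y)%:E * k x y)%E).
  - exact: slice.
  by apply: (ae_impl _ (ae_neq 0)) => y y0 _; exact: le_G.
have intG : (\int[mu]_x \int[mu]_y G x y = (K * (16 * N * A))%:E)%E.
  transitivity (\int[mu]_x (K%:E * (\int[mu]_y F x y + \int[mu]_y F y x)))%E.
    apply: eq_integral => x _; rewrite /G ge0_integralZl//.
    - rewrite ge0_integralD//; first exact: slice.
      exact: (slice (fun x y => F y x)).
    - by apply: emeasurable_funD; [exact: slice|exact: (slice (fun x y => F y x))].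
    - by move=> y _; rewrite adde_ge0.
    - by rewrite lee_fin ltW.
  have oF := outer _ mF F0; have oFC := outer (fun x y => F y x) mFC (fun x y => F0 y x).
  have iF0 x : (0 <= \int[mu]_y F x y)%E by exact: integral_ge0.
  have iFC0 x : (0 <= \int[mu]_y F y x)%E by exact: integral_ge0.
  rewrite ge0_integralZl//; first last.
  - by rewrite lee_fin ltW.
  - by move=> x _; rewrite adde_ge0.
  - exact: (emeasurable_funD oF oFC).
  rewrite ge0_integralD; [|exact: measurableT|by move=> x _; exact: iF0
    |exact: oF|by move=> x _; exact: iFC0|exact: oFC].
  transitivity (K%:E * ((8 * N * A)%:E + (8 * N * A)%:E))%E.
    by congr (_ * (_ + _))%E; [exact: intF|exact: intFC].
  rewrite -EFinD -EFinM; congr EFin; ring.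
rewrite /energy; apply: (@le_trans _ _ ((2^-1)%:E * (K * (16 * N * A))%:E)%E).
  by rewrite lee_wpmul2l ?lee_fin ?invr_ge0// -intG.
rewrite -EFinM lee_fin le_eqVlt; apply/orP; left; apply/eqP.
by rewrite /K; field; rewrite gt_eqF.
Qed.

End CutoffEnergy.

(** * Criticality of the zero weight when alpha = 1 *)

Section Criticality.
Context {R : realType}.
Local Notation mu := (@lebesgue_measure R).
Variables (k : R -> R -> \bar R) (p : R).
Hypotheses (hk : hom_kernel 1 k) (p1 : 1 < p).

Let p0 : 0 < p. Proof. exact: lt_trans p1. Qed.

Lemma open_Rstar : open (@Rstar R).
Proof. exact: open_neq. Qed.

Lemma hardy_weight0 : hardy_weight k p (fun=> 0).
Proof.
split.
  split; [exact: measurable_cst|exact: open_Rstar|move=> K _ _].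
  by rewrite integral0_eq// => x _; rewrite normr0.
move=> u _; rewrite integral0_eq; first exact: energy_ge0.
by move=> x _; rewrite mulr0.
Qed.

(** The test function equals 1 on [D]. Replacing [W] by its positive part, equal to it almost
    everywhere, makes the integrand nonnegative at every point, so that restricting to [D] can only
    decrease the integral. *)
Lemma hardy_weight_cutoff (W : R -> R) (D : set R) (N : R) :
  hardy_weight k p W -> {ae mu, forall x, 0 <= W x} -> measurable D -> D `<=` @Rstar R ->
  0 < N -> (forall x, D x -> expR (- N) <= `|x| <= expR N) ->
  (\int[mu]_(x in D) (Num.max (W x) 0)%:E <= energy k p (cutoff_fun N p))%E.
Proof.
move=> [[mW _ _] HW] W0 mD DR N0 DN.
set u := cutoff_fun N p.
have Cu : Cc_Rstar u by exact: Cc_cutoff_fun.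
have mR : measurable (@Rstar R) by apply: open_measurable; exact: open_Rstar.
have mu' : measurable_fun (@Rstar R) (fun x => `|u x| `^ p).
  apply: measurable_funTS; apply: measurable_powRl; apply: measurableT_comp => //.
  by apply: continuous_measurable_fun; exact: Cu.1.
have mf : measurable_fun (@Rstar R) (fun x => (`|u x| `^ p * W x)%:E).
  by apply/measurable_EFinP; exact: measurable_funM.
have mmax : measurable_fun (@Rstar R) (fun x => Num.max (W x) 0).
  exact: measurable_maxr.
have mg : measurable_fun (@Rstar R) (fun x => (`|u x| `^ p * Num.max (W x) 0)%:E).
  by apply/measurable_EFinP; exact: measurable_funM.
apply: le_trans (HW u Cu).
(* Measurability of [W] is known only off 0, so the origin is removed before the integrands are
   compared. *)
have RE : [set: R] `\ 0 = @Rstar R.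
  by apply/seteqP; split => [x [_ /eqP]|x /= /eqP x0]; [|split].
rewrite -(@integral_setD1 _ _ 0 [set: R]) RE//.
rewrite [leRHS](@ae_eq_integral _ (measurableTypeR R) R mu _
  (fun x => (`|u x| `^ p * Num.max (W x) 0)%:E))//; last first.
  by apply: (ae_impl _ W0) => x Wx _; rewrite max_l.
apply: (@le_trans _ _ (\int[mu]_(x in D) (`|u x| `^ p * Num.max (W x) 0)%:E)%E); last first.
  apply: ge0_subset_integral => // x _.
  by rewrite lee_fin mulr_ge0 ?powR_ge0// le_max lexx orbT.
rewrite le_eqVlt; apply/orP; left; apply/eqP; apply: eq_integral => x /set_mem Dx.
by rewrite /u /cutoff_fun log_cutoff_in ?DN// powR1 normr1 powR1 mul1r.
Qed.

Lemma critical_hardy_weight0 : critical_hardy_weight k p (fun=> 0).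
Proof.
split; first exact: hardy_weight0.
move=> W hW W0.
have [C [C0 EC]] := energy_cutoff_le _ _ hk p1.
have zero_on (m : nat) :
    {ae mu, forall x, expR (- m%:R) <= `|x| <= expR m%:R -> W x = 0}.
  pose D : set R := [set x | expR (- m%:R) <= `|x| <= expR m%:R].
  have DR : D `<=` @Rstar R.
    move=> x /= /andP[x1 _]; rewrite /Rstar/= -normr_gt0.
    by rewrite (lt_le_trans _ x1)// expR_gt0.
  have mD : measurable D.
    rewrite (_ : D = (fun x : R => `|x|) @^-1` `[expR (- m%:R), expR m%:R]).
      by rewrite -[X in measurable X]setTI; exact: normr_measurable.
    by apply/seteqP; split => x /=; rewrite in_itv.
  have mR : measurable (@Rstar R) by apply: open_measurable; exact: open_Rstar.
  have mmax : measurable_fun D (fun x => (Num.max (W x) 0)%:E).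
    apply/measurable_EFinP; apply: measurable_maxr => //.
    by apply: measurable_funS DR _ => //; case: hW => -[].
  have max0 x : D x -> (0 <= (Num.max (W x) 0)%:E)%E.
    by move=> _; rewrite lee_fin le_max lexx orbT.
  have int0 : (\int[mu]_(x in D) (Num.max (W x) 0)%:E = 0)%E.
    apply/eqP; rewrite eq_le integral_ge0// andbT.
    apply/lee_addgt0Pr => e e0; rewrite add0e.
    (* N >= m puts the annulus inside the plateau of the cutoff, N >= C / e makes the energy at most
       e, and the 1 keeps N positive. *)
    pose N := m%:R + 1 + C / e.
    have N0 : 0 < N by rewrite ltr_wpDr ?divr_ge0 ?ltr_wpDl// ltW.
    have mN : m%:R <= N by rewrite /N -addrA lerDl addr_ge0// divr_ge0// ltW.
    apply: (@le_trans _ _ (C / N)%:E).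
      apply: le_trans (EC _ N0); apply: hardy_weight_cutoff => // x /= /andP[x1 x2].
      by rewrite (le_trans _ x1) ?ler_expR ?lerN2//= (le_trans x2)// ler_expR.
    rewrite lee_fin ler_pdivrMr// mulrC -ler_pdivrMr//.
    by rewrite /N lerDr addr_ge0.
  have := ge0_integral_eq0_ae mD mmax max0 int0.
  apply: (ae_impl2 _ W0) => x Wx H Dx; move: (H Dx) => [].
  by rewrite max_l.
(* Countably many annuli exhaust the punctured line, so the exceptional null sets can be united. *)
have /ae_foralln all0 := zero_on.
apply: (ae_impl2 _ all0 (ae_neq 0)) => x Hx x0.
have nx0 : 0 < `|x| by rewrite normr_gt0.
have [m hm] : exists m : nat, `|ln `|x| | <= m%:R.
  by exists (Num.truncn `|ln `|x| |).+1; rewrite ltW// truncnS_gt.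
apply: (Hx m); rewrite -{1 2}(lnK nx0) !ler_expR -ler_norml.
exact: hm.
Qed.

End Criticality.

Theorem theorem3p5 (R : realType) (p : R) (hp : 1 < p) :
  (forall k : R -> R -> \bar R,
     hom_kernel 1 k -> critical_hardy_weight k p (fun=> 0))
  /\
  (forall (alpha : R) (k : R -> R -> \bar R),
     0 < alpha -> alpha < 2 -> alpha != 1 ->
     hom_kernel alpha k -> reducible k -> ~ kernel_ae0 k ->
     (forall s s' x : R, 0 < s -> 0 < s' -> x != 0 ->
        hardy_W alpha k p s x = hardy_W alpha k p s' x)
     /\ (forall s x : R, 0 < s -> x != 0 -> (0 <= hardy_W alpha k p s x)%E)
     /\ ((forall s x : R, 0 < s -> 0 < x -> (0 < hardy_W alpha k p s x)%E)
         \/ (forall s x : R, 0 < s -> x < 0 -> (0 < hardy_W alpha k p s x)%E)))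
  /\
  (forall (alpha : R) (k : R -> R -> \bar R),
     0 < alpha -> alpha < 2 -> alpha != 1 ->
     hom_kernel alpha k -> irreducible k ->
     (exists S : set R,
        [/\ S !=set0, open S, is_interval S, S `<=` [set s | 0 < s] &
            forall s x : R, S s -> x != 0 -> (0 < hardy_W alpha k p s x)%E])
     /\ (exists s0 D : R, 0 < s0 /\ 0 < D /\
           forall x : R, x != 0 ->
             hardy_W alpha k p s0 x = (D * `|x| `^ (- alpha))%:E)).
Proof.
split; first by move=> k hk; exact: critical_hardy_weight0.
split=> alpha k al0 al2 al1 hk.
  exact: hardy_W_reducible.
exact: hardy_W_irreducible.
Qed.
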